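(* Let $n\ge1$ be an integer, let $0\neq\mu=\sum_{i=1}^n\mu_i\varepsilon_i\in\Lambda^+$ with $\mathcal{S}(\mu)=\{n_0,n_1,\dots,n_s\}$, and define $$\Theta(\mu)=\begin{cases}\emptyset&\text{if }\mu=\frac12\sum_{i=1}^n\varepsilon_i,\\ \mu_1+2n-n_1-\mathbb{N}&\text{otherwise.}\end{cases}$$ Then the generalized conformal $o(2n+3,\mathbb{C})$-module $\widehat{V(\mu)}$ with constant $b$ is irreducible if $$b\in\mathbb{C}\setminus\Big(\big(n-\tfrac12\mathbb{N}\big)\cup\Theta(\mu)\Big).$$
   Context: $\mathbb{N}=\{0,1,2,\dots\}$; for $c\in\mathbb C$, $c-\mathbb{N}=\{c-k:k\in\mathbb{N}\}$ and $c-\frac12\mathbb{N}=\{c-k/2:k\in\mathbb{N}\}$. $E_{r,s}$ denotes the matrix with $1$ in entry $(r,s)$ and $0$ elsewhere. Let $I=\{0,1,\dots,2n\}$ with involution $i'=n+i$, $(n+i)'=i$ for $1\le i\le n$, $0'=0$. $o(2n+1,\mathbb{C})$ is the span of $F_{i,j}=E_{i,j}-E_{j',i'}$ ($i,j\in I$). $o(2n+3,\mathbb{C})$ is the span of $\hat F_{r,s}=E_{r,s}-E_{s^*,r^*}$ for $r,s\in\{0,1,\dots,2n+2\}$, where $i^*=n+1+i$, $(n+1+i)^*=i$ for $1\le i\le n+1$, and $0^*=0$. Weights. The Cartan subalgebra of $o(2n+1,\mathbb{C})$ is $\sum_{i=1}^n\mathbb{C}F_{i,i}$, $\varepsilon_i(F_{j,j})=\delta_{i,j}$,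 the positive roots are $\varepsilon_i\pm\varepsilon_j$ ($1\le i<j\le n$) and $\varepsilon_r$ ($1\le r\le n$), and the dominant integral weights are $\Lambda^+=\{\sum_{i=1}^n\mu_i\varepsilon_i:\mu_i\in\frac12\mathbb{N},\ \mu_i-\mu_{i+1}\in\mathbb{N}\ (1\le i\le n-1)\}$. $V(\mu)$ is the finite-dimensional irreducible $o(2n+1,\mathbb{C})$-module of highest weight $\mu$. For $\mu\in\Lambda^+$, $\mathcal{S}(\mu)=\{n_0,n_1,\dots,n_s\}$ is the unique sequence $0=n_0<n_1<\cdots<n_s=n$ such that $\mu_i=\mu_j$ if and only if $n_r<i,j\le n_{r+1}$ for some $r\in\{0,\dots,s-1\}$. Conformal operators. Let $\mathcal{A}=\mathbb{C}[x_0,x_1,\dots,x_{2n}]$, $\partial_i=\partial_{x_i}$, $\eta=\frac12x_0^2+\sum_{i=1}^nx_ix_{n+i}$, and for $i,j\in I$ $$D=\sum_{r\in I}x_r\partial_r,\qquad J_i=x_iD-\eta\,\partial_{i'},\qquad L_{i,j}=x_i\partial_j-x_{j'}\partial_{i'}.$$ The span $\mathcal{C}_{2n+1}$ of $D$ and all $\partial_i,J_i,L_{i,j}$ is a Lie algebra, and with $\kappa(i)=i$, $\kappa(n+i)=n+1+i$ ($1\le i\le n$), $\kappa(0)=0$ there is a Lie algebra isomorphism $\vartheta:o(2n+3,\mathbb{C})\to\mathcal{C}_{2n+1}$ given by $\vartheta(\hat F_{\kappa(i),\kappa(j)})=L_{i,j}$, $\vartheta(\hat F_{n+1,n+1})=-D$,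 $\vartheta(\hat F_{n+1,\kappa(i)})=\partial_i$, $\vartheta(\hat F_{\kappa(i),n+1})=-J_i$. Generalized conformal module. For an $o(2n+1,\mathbb{C})$-module $M$ and $b\in\mathbb{C}$, $\widehat M=\mathcal{A}\otimes_{\mathbb{C}}M$ is a $\mathcal{C}_{2n+1}$-module via, for $g\in\mathcal{A}$, $v\in M$, $$\partial_i(g\otimes v)=\partial_i(g)\otimes v,\quad D(g\otimes v)=(D(g)+bg)\otimes v,\quad L_{i,j}(g\otimes v)=L_{i,j}(g)\otimes v+g\otimes F_{i,j}(v),$$ $$J_i(g\otimes v)=\big(J_i(g)+b\,x_ig\big)\otimes v+\sum_{p\in I}x_pg\otimes F_{i,p}(v),$$ and it becomes an $o(2n+3,\mathbb{C})$-module by letting $A\in o(2n+3,\mathbb{C})$ act as $\vartheta(A)$. *)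

(* Defs.v *)
From HB Require Import structures.
From mathcomp Require Import all_boot all_order all_algebra.
From mathcomp Require Import mpoly zify.
Set Implicit Arguments.
Unset Strict Implicit.
Unset Printing Implicit Defensive.
Import GRing.Theory.
Local Open Scope ring_scope.

(* The index set {0, 1, ..., 2N}.  The two orthogonal algebras are treated
   uniformly: o(2n+1) is [orth C n] and o(2n+3) is [orth C n.+1]. *)
Notation idx N := 'I_(N.*2.+1).

(* i |-> i' on idx n; on idx n.+1 it is i |-> i^* *)
Definition inv (N : nat) (i : idx N) : idx N :=
  inord (if i == 0 :> nat then 0%N
         else if (i <= N)%N then (N + i)%N else (i - N)%N).

(* Ordinals start at 0: [i : 'I_n] stands for the 1-based index i + 1. *)
Definition pos (n : nat) (i : 'I_n) : idx n := inord i.+1.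

Section Orthogonal.
Variable C : fieldType.

Definition F (N : nat) (i j : idx N) : 'M[C]_(N.*2.+1) :=
  delta_mx i j - delta_mx (inv j) (inv i).

Definition orth (N : nat) : {vspace 'M[C]_(N.*2.+1)} :=
  (\sum_(i < N.*2.+1) \sum_(j < N.*2.+1) <[F i j]>)%VS.

(* [A |-> rho A] is a representation on C^d; only the values of [rho] on [L]
   matter. *)
Definition is_rep (m d : nat) (L : {vspace 'M[C]_m})
    (rho : 'M[C]_m -> 'M[C]_d) : Prop :=
  (forall (a : C) (A B : 'M[C]_m), A \in L -> B \in L ->
     rho (a *: A + B) = a *: rho A + rho B) /\
  (forall A B : 'M[C]_m, A \in L -> B \in L ->
     rho (A *m B - B *m A) = rho A *m rho B - rho B *m rho A).

Definition is_subspace (V : lmodType C) (W : V -> Prop) : Prop :=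
  W 0 /\ forall (a : C) (u v : V), W u -> W v -> W (a *: u + v).

Definition irreducible_module (m : nat) (L : {vspace 'M[C]_m})
    (V : lmodType C) (act : 'M[C]_m -> V -> V) : Prop :=
  (exists v : V, v <> 0) /\
  forall W : V -> Prop, is_subspace W ->
    (forall (A : 'M[C]_m) (v : V), A \in L -> W v -> W (act A v)) ->
    (forall v : V, W v -> v = 0) \/ (forall v : V, W v).

(* The weight sum_i mu_i eps_i is the row vector of the mu_i. *)
Definition eps (n : nat) (i : 'I_n) : 'rV[C]_n := delta_mx 0 i.

Definition positive_root (n : nat) (alpha : 'rV[C]_n) : Prop :=
  (exists i j : 'I_n, (i < j)%N /\
     (alpha = eps i + eps j \/ alpha = eps i - eps j)) \/
  (exists r : 'I_n, alpha = eps r).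

Definition in_root_space (n : nat) (alpha : 'rV[C]_n) (X : 'M[C]_(n.*2.+1)) :
    Prop :=
  X \in orth n /\
  forall k : 'I_n,
    F (pos k) (pos k) *m X - X *m F (pos k) (pos k) = alpha 0 k *: X.

Definition dominant_integral (n : nat) (mu : 'rV[C]_n) : Prop :=
  (forall i : 'I_n, exists k : nat, mu 0 i = k%:R / 2%:R) /\
  (forall i j : 'I_n, j = i.+1 :> nat -> exists k : nat, mu 0 i - mu 0 j = k%:R).

Definition highest_weight_vector (n d : nat) (mu : 'rV[C]_n)
    (rho : 'M[C]_(n.*2.+1) -> 'M[C]_d) (v : 'cV[C]_d) : Prop :=
  [/\ v <> 0,
      forall k : 'I_n, rho (F (pos k) (pos k)) *m v = mu 0 k *: v
    & forall (alpha : 'rV[C]_n) (X : 'M[C]_(n.*2.+1)),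
        positive_root alpha -> in_root_space alpha X -> rho X *m v = 0].

(* [rho] is a realisation on C^d of the irreducible o(2n+1)-module V(mu). *)
Definition is_V (n d : nat) (mu : 'rV[C]_n)
    (rho : 'M[C]_(n.*2.+1) -> 'M[C]_d) : Prop :=
  [/\ is_rep (orth n) rho,
      irreducible_module (orth n) (fun A (v : 'cV[C]_d) => rho A *m v)
    & exists v : 'cV[C]_d, highest_weight_vector mu rho v].

(* S = {n_0, ..., n_s}, with n_r = nth 0 S r *)
Definition is_jumps (n : nat) (mu : 'rV[C]_n) (S : seq nat) : Prop :=
  [/\ (0 < size S)%N, nth 0%N S 0 = 0%N, nth 0%N S (size S).-1 = n,
      sorted ltn S
    & forall i j : 'I_n, mu 0 i = mu 0 j <->
        exists r : nat, [/\ (r.+1 < size S)%N,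
          (nth 0%N S r < i.+1 <= nth 0%N S r.+1)%N
        & (nth 0%N S r < j.+1 <= nth 0%N S r.+1)%N]].

Definition Theta (n : nat) (hn : (0 < n)%N) (mu : 'rV[C]_n) (S : seq nat)
    (b : C) : Prop :=
  mu <> 2%:R^-1 *: \sum_(i < n) eps i /\
  exists k : nat,
    b = mu 0 (Ordinal hn) + (n.*2)%:R - (nth 0%N S 1)%:R - k%:R.

End Orthogonal.

(* the polynomial algebra C[x_0, ..., x_2n] *)
Notation polA C n := {mpoly C[n.*2.+1]}.
(* A (x) C^d, realised as A^d; see [tens] *)
Notation Mhat C n d := {ffun 'I_d -> polA C n}.

Section Conformal.
Variables (C : fieldType) (n : nat).

Definition eta : polA C n :=
  2%:R^-1 *: ('X_ord0 * 'X_ord0) + \sum_(i < n) 'X_(pos i) * 'X_(inv (pos i)).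

Definition opD (g : polA C n) : polA C n := \sum_(r < n.*2.+1) 'X_r * g^`M(r).
Definition opJ (i : idx n) (g : polA C n) : polA C n :=
  'X_i * opD g - eta * g^`M(inv i).
Definition opL (i j : idx n) (g : polA C n) : polA C n :=
  'X_i * g^`M(j) - 'X_(inv j) * g^`M(inv i).

Definition kappa (i : idx n) : idx n.+1 :=
  inord (if (i <= n)%N then i : nat else i.+1).
Definition np1 : idx n.+1 := inord n.+1.

(* The linear map on o(2n+3) sending Fhat_(n+1,n+1) to -D,
   Fhat_(n+1,kappa i) to P i, Fhat_(kappa i,n+1) to -J i and
   Fhat_(kappa i,kappa j) to L i j.  The coefficients below expand A in these
   generators; the factor 1/2 is there because
   Fhat_(kappa i,kappa j) = - Fhat_(kappa j',kappa i'). *)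
Definition theta (V : lmodType C) (D : V) (P J : idx n -> V)
    (L : idx n -> idx n -> V) (A : 'M[C]_(n.+1.*2.+1)) : V :=
  - (A np1 np1 *: D)
  + \sum_(i < n.*2.+1) A np1 (kappa i) *: P i
  - \sum_(i < n.*2.+1) A (kappa i) np1 *: J i
  + 2%:R^-1 *:
    \sum_(i < n.*2.+1) \sum_(j < n.*2.+1) A (kappa i) (kappa j) *: L i j.

(* the pure tensor g (x) v *)
Definition tens (d : nat) (g : polA C n) (v : 'cV[C]_d) : Mhat C n d :=
  [ffun k => v k 0 *: g].

(* T (x) id and id (x) M *)
Definition tensl (d : nat) (T : polA C n -> polA C n) (w : Mhat C n d) : Mhat C n d :=
  [ffun k => T (w k)].
Definition tensr (d : nat) (M : 'M[C]_d) (w : Mhat C n d) : Mhat C n d :=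
  [ffun k => \sum_(l < d) M k l *: w l].

Section Action.
Variables (d : nat) (rho : 'M[C]_(n.*2.+1) -> 'M[C]_d) (b : C).

Definition actP (i : idx n) (w : Mhat C n d) : Mhat C n d :=
  tensl (fun g => g^`M(i)) w.
Definition actD (w : Mhat C n d) : Mhat C n d := tensl (fun g => opD g + b *: g) w.
Definition actL (i j : idx n) (w : Mhat C n d) : Mhat C n d :=
  tensl (opL i j) w + tensr (rho (F C i j)) w.
Definition actJ (i : idx n) (w : Mhat C n d) : Mhat C n d :=
  tensl (fun g => opJ i g + b *: ('X_i * g)) w
  + \sum_(p < n.*2.+1) tensl (fun g => 'X_p * g) (tensr (rho (F C i p)) w).

Definition act_hat (A : 'M[C]_(n.+1.*2.+1)) (w : Mhat C n d) : Mhat C n d :=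
  theta (actD w) (actP^~ w) (actJ^~ w) (fun i j => actL i j w) A.

End Action.

Lemma tensr_tens (d : nat) (M : 'M[C]_d) (g : polA C n) (v : 'cV[C]_d) :
  tensr M (tens g v) = tens g (M *m v).
Proof.
apply/ffunP=> k; rewrite !ffunE mxE scaler_suml.
by apply: eq_bigr => l _; rewrite !ffunE scalerA.
Qed.

Lemma tensl_tens (d : nat) (T : {linear polA C n -> polA C n}) (g : polA C n)
    (v : 'cV[C]_d) : tensl T (tens g v) = tens (T g) v.
Proof. by apply/ffunP=> k; rewrite !ffunE linearZ. Qed.

Lemma opD_scale a g : opD (a *: g) = a *: opD g.
Proof.
by rewrite /opD scaler_sumr; apply: eq_bigr=> r _; rewrite mderivZ scalerAr.
Qed.

Section PureTensors.
Variables (d : nat) (rho : 'M[C]_(n.*2.+1) -> 'M[C]_d) (b : C).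
Variables (g : polA C n) (v : 'cV[C]_d).

Lemma actP_tens i : actP i (tens g v) = tens g^`M(i) v.
Proof. by apply/ffunP=> k; rewrite !ffunE mderivZ. Qed.

Lemma actD_tens : actD b (tens g v) = tens (opD g + b *: g) v.
Proof.
by apply/ffunP=> k; rewrite !ffunE opD_scale scalerDr !scalerA mulrC.
Qed.

Lemma actL_tens i j :
  actL rho i j (tens g v) = tens (opL i j g) v + tens g (rho (F C i j) *m v).
Proof.
rewrite /actL tensr_tens; congr (_ + _); apply/ffunP=> k.
by rewrite !ffunE /opL !mderivZ -!scalerAr scalerBr.
Qed.

Lemma actJ_tens i :
  actJ rho b i (tens g v) =
  tens (opJ i g + b *: ('X_i * g)) v
  + \sum_(p < n.*2.+1) tens ('X_p * g) (rho (F C i p) *m v).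
Proof.
rewrite /actJ; congr (_ + _).
  apply/ffunP=> k; rewrite !ffunE /opJ opD_scale mderivZ -!scalerAr.
  rewrite scalerDr scalerBr; congr (_ - _ + _).
  by rewrite !scalerA mulrC.
apply: eq_bigr => p _; rewrite tensr_tens; apply/ffunP=> k.
by rewrite !ffunE -scalerAr.
Qed.

End PureTensors.
Lemma val_kappa (i : idx n) : kappa i = (if (i <= n)%N then i : nat else i.+1) :> nat.
Proof.
by rewrite /kappa inordK //; have := ltn_ord i; rewrite doubleS; case: ifP; lia.
Qed.

Lemma val_np1 : np1 = n.+1 :> nat.
Proof. by rewrite /np1 inordK // doubleS; lia. Qed.

Lemma val_inv N (i : idx N) : inv i = (if i == 0 :> nat then 0%N
         else if (i <= N)%N then (N + i)%N else (i - N)%N) :> nat.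
Proof.
rewrite /inv inordK //; have := ltn_ord i.
by case: ifP => // _; case: ifP; lia.
Qed.

Lemma invK N : involutive (@inv N).
Proof.
move=> i; apply: val_inj; rewrite /= !val_inv; have := ltn_ord i.
by do ![case: ifP => //]; lia.
Qed.

Lemma kappa_inj : injective kappa.
Proof.
move=> i j /(congr1 val); rewrite /= !val_kappa => h; apply: val_inj => /=.
by move: h; do 2!case: ifP; lia.
Qed.

Lemma inv_kappa i : inv (kappa i) = kappa (inv i).
Proof.
apply: val_inj; rewrite /= val_inv !val_kappa val_inv.
have := ltn_ord i.
by do ![case: ifP]; lia.
Qed.

Lemma kappa_np1 i : (kappa i == np1) = false.
Proof.
by apply/eqP=> /(congr1 val); rewrite /= val_kappa val_np1; case: ifP; lia.
Qed.

Lemma inv_np1_kappa i : (kappa i == inv np1) = false.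
Proof.
apply/eqP=> /(congr1 val); rewrite /= val_kappa val_inv val_np1.
by have := ltn_ord i; do ![case: ifP]; lia.
Qed.

Lemma inv_np1 : (np1 == inv np1) = false.
Proof.
by apply/eqP=> /(congr1 val); rewrite /= val_inv val_np1; do ![case: ifP]; lia.
Qed.

Section ThetaGenerators.
Variables (V : lmodType C) (D : V) (P J : idx n -> V) (L : idx n -> idx n -> V).

Let FE (r s p q : idx n.+1) : F C r s p q =
  ((p == r) && (q == s))%:R - ((p == inv s) && (q == inv r))%:R.
Proof. by rewrite !mxE. Qed.

Let sum_delta (f : idx n -> V) i : \sum_j (j == i)%:R *: f j = f i.
Proof.
rewrite (bigD1 i) //= eqxx scale1r big1 ?addr0 // => j /negPf->.
by rewrite scale0r.
Qed.

Let kE i j : (kappa i == kappa j) = (i == j).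
Proof. exact: inj_eq kappa_inj _ _. Qed.

Let sum0 (I : finType) (f : I -> C) (g : I -> V) :
  (forall i, f i = 0) -> \sum_i f i *: g i = 0.
Proof. by move=> f0; rewrite big1 // => i _; rewrite f0 scale0r. Qed.

Let np1_kappa i : (np1 == kappa i) = false.
Proof. by rewrite eq_sym kappa_np1. Qed.

Let zeroE := (inv_kappa, np1_kappa, inv_np1, kappa_np1, inv_np1_kappa, andbF,
  andFb).

Lemma theta_np1_np1 : theta D P J L (F C np1 np1) = - D.
Proof.
rewrite /theta FE !eqxx inv_np1 subr0 scale1r.
rewrite !sum0 => [|i|i]; rewrite ?FE ?kappa_np1 ?inv_np1_kappa ?andbF ?subrr //.
rewrite big1 => [|i _]; first by rewrite scaler0 addr0 subr0 addr0.
by rewrite sum0 // => j; rewrite FE !zeroE subrr.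
Qed.

Lemma theta_np1_kappa i : theta D P J L (F C np1 (kappa i)) = P i.
Proof.
rewrite /theta FE inv_kappa !np1_kappa andbF /= subrr scale0r oppr0 add0r.
under eq_bigr => j _ do rewrite FE inv_kappa np1_kappa eqxx kE subr0.
rewrite sum_delta sum0 => [|j]; last first.
  by rewrite FE !zeroE subrr.
rewrite big1 => [|j _]; first by rewrite scaler0 addr0 subr0.
by rewrite sum0 // => k; rewrite FE !zeroE subrr.
Qed.

Lemma theta_kappa_np1 i : theta D P J L (F C (kappa i) np1) = - J i.
Proof.
rewrite /theta FE inv_kappa !np1_kappa andbF /= subrr scale0r oppr0 add0r.
rewrite sum0 => [|j]; last first.
  by rewrite FE !zeroE subrr.
under eq_bigr => j _ do rewrite FE inv_np1_kappa eqxx andbT kE subr0.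
rewrite sum_delta add0r big1 => [|j _]; first by rewrite scaler0 addr0.
by rewrite sum0 // => k; rewrite FE !zeroE subrr.
Qed.

Lemma theta_kappa_kappa i j : 2%:R != 0 :> C ->
  L (inv j) (inv i) = - L i j ->
  theta D P J L (F C (kappa i) (kappa j)) = L i j.
Proof.
move=> C2 Lanti; rewrite /theta FE !inv_kappa !np1_kappa /= subrr scale0r oppr0 add0r.
rewrite sum0 => [|k]; last by rewrite FE !zeroE subrr.
rewrite sum0 => [|k]; last by rewrite FE !zeroE subrr.
rewrite subr0 add0r.
transitivity (2%:R^-1 *: (L i j - L (inv j) (inv i))); last first.
  by rewrite Lanti opprK -mulr2n -scaler_nat scalerA mulVf ?scale1r.
congr (_ *: _).
rewrite -[L i j](sum_delta (L^~ j)) -[L (inv j) _](sum_delta (L^~ (inv i))).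
rewrite -sumrB; apply: eq_bigr => p _.
rewrite -(sum_delta (L p) j) -(sum_delta (L p) (inv i)) !scaler_sumr -sumrB.
apply: eq_bigr => q _; rewrite FE !inv_kappa !kE -!mulnb !natrM scalerBl.
by rewrite !scalerA.
Qed.

End ThetaGenerators.

Lemma actL_anti d (rho : 'M[C]_(n.*2.+1) -> 'M[C]_d) (i j : idx n)
    (w : Mhat C n d) :
  is_rep (orth C n) rho -> actL rho (inv j) (inv i) w = - actL rho i j w.
Proof.
case=> rhoL _.
have Fo p q : F C p q \in orth C n.
  apply: (subvP (sumv_sup p _ (sumv_sup q _ (subvv _)))) => //.
  exact: memv_line.
have Fa : F C (inv j) (inv i) = (-1) *: F C i j + 0.
  by rewrite /F !invK addr0 scaleN1r opprB.
have rho0 : rho 0 = 0.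
  have := rhoL (-1) 0 0 (mem0v _) (mem0v _).
  by rewrite scaler0 addr0 scaleN1r addNr.
apply/ffunP=> k; rewrite !ffunE Fa rhoL ?mem0v // rho0 addr0 scaleN1r.
rewrite opprD /opL !invK opprB; congr (_ + _).
by rewrite -sumrN; apply: eq_bigr => l _; rewrite mxE scaleNr.
Qed.

(* The action of the generators of o(2n+3) on the generalized conformal
   module *)
Lemma act_hat_generators d (rho : 'M[C]_(n.*2.+1) -> 'M[C]_d) (b : C)
    (w : Mhat C n d) (i j : idx n) :
  2%:R != 0 :> C -> is_rep (orth C n) rho ->
  [/\ act_hat rho b (F C (kappa i) (kappa j)) w = actL rho i j w,
      act_hat rho b (F C np1 np1) w = - actD b w,
      act_hat rho b (F C np1 (kappa i)) w = actP i w
    & act_hat rho b (F C (kappa i) np1) w = - actJ rho b i w].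
Proof.
move=> C2 rep; split; rewrite /act_hat.
- by rewrite theta_kappa_kappa // actL_anti.
- exact: theta_np1_np1.
- exact: theta_np1_kappa.
- exact: theta_kappa_np1.
Qed.

End Conformal.

(* Main.v *)
Require Import Defs.
From HB Require Import structures.
From mathcomp Require Import all_boot all_order all_algebra.
From mathcomp Require Import reals complex mpoly.
From mathcomp Require Import boolp ring zify.
(* [Defs] is imported again because [fraction] shadows its [inv]. *)
Import Defs.
Import GRing.Theory.
Local Open Scope ring_scope.

Set Implicit Arguments.
Unset Strict Implicit.
Unset Printing Implicit Defensive.

(* A nonzero submodule W contains 1 (x) M: differentiate down to constants and use
   the irreducibility of M = V(mu).  To climb from degree k-1 to degree k, let
   the matrix AA = (Fhat_rs) act on (natural o(2n+3)-module) (x) (A (x) M).  It is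
   block triangular, with diagonal blocks -b, om - 1 and b - 2n - 1, where om is
   the split Casimir operator on (natural o(2n+1)-module) (x) M; hence it is
   annihilated by (t + b) p(t + 1) (t - b + 2n + 1) as soon as p(om) = 0.  Modulo
   lower degrees, AA multiplies e_(n+1) (x) w by -(b + k) when w has degree k, so
   w lies in W unless -(b + k) is a root.  The eigenvalues of om are mu_i - i + 1,
   -n and -mu_i - 2n + i, where the last one occurs only if mu - eps_i is
   dominant; the excluded values of b are exactly what rules all of them out. *)

(** * Closure properties of subspaces given as predicates *)

Section Subspaces.
Variables (C : fieldType) (V : lmodType C) (S : V -> Prop).
Hypothesis subS : is_subspace S.

Lemma subspaceD u v : S u -> S v -> S (u + v).
Proof. by move=> Su Sv; rewrite -[u]scale1r; apply: subS.2. Qed.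

Lemma subspaceZ a u : S u -> S (a *: u).
Proof. by move=> Su; rewrite -[_ *: _]addr0; apply: subS.2 => //; apply: subS.1. Qed.

Lemma subspaceN u : S u -> S (- u).
Proof. by rewrite -scaleN1r; apply: subspaceZ. Qed.

Lemma subspaceB u v : S u -> S v -> S (u - v).
Proof. by move=> Su Sv; apply/subspaceD/subspaceN. Qed.

Lemma subspace_sum (I : Type) (r : seq I) (P : pred I) (f : I -> V) :
  (forall i, P i -> S (f i)) -> S (\sum_(i <- r | P i) f i).
Proof. by move=> Sf; apply: big_ind => //; [apply: subS.1|apply: subspaceD]. Qed.

End Subspaces.

(** * Products of shifted operators *)

Section ShiftedProducts.
Variables (C : fieldType) (V : lmodType C) (f : V -> V).
Hypothesis linf : linear f.

Definition shifted_prod (cs : seq C) (v : V) : V :=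
  foldr (fun c u => f u - c *: u) v cs.

(** Sums of generalised eigenvectors of [f] with eigenvalues in [P]: [cs] may repeat values, so [f]
    need not be diagonalisable. *)
Definition shift_torsion (P : C -> Prop) (v : V) : Prop :=
  exists2 cs, {in cs, forall c, P c} & shifted_prod cs v = 0.

Let fD u v : f (u + v) = f u + f v.
Proof. by rewrite -[u]scale1r linf !scale1r. Qed.

Let f0 : f 0 = 0.
Proof. by apply: (addrI (f 0)); rewrite -fD !addr0. Qed.

Let fZ a u : f (a *: u) = a *: f u.
Proof. by rewrite -[a *: u]addr0 linf f0 addr0. Qed.

Let fB u v : f (u - v) = f u - f v.
Proof. by rewrite fD -!scaleN1r fZ. Qed.

Lemma shifted_prod_linear cs : linear (shifted_prod cs).
Proof.
move=> a u v; elim: cs => //= c cs ->; rewrite linf.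
by rewrite scalerBr !scalerDr !scalerA (mulrC c) opprD addrACA.
Qed.

Lemma shifted_prod0 cs : shifted_prod cs 0 = 0.
Proof. by elim: cs => //= c cs ->; rewrite f0 scaler0 subr0. Qed.

Lemma shifted_prodC c cs v :
  shifted_prod cs (f v - c *: v) = f (shifted_prod cs v) - c *: shifted_prod cs v.
Proof.
elim: cs => //= c' cs ->.
by rewrite !fB !fZ !scalerBr !scalerA (mulrC c') !opprD addrACA.
Qed.

Lemma shifted_prod_catC cs cs' v :
  shifted_prod cs (shifted_prod cs' v) = shifted_prod cs' (shifted_prod cs v).
Proof. by elim: cs' => //= c cs' <-; rewrite shifted_prodC. Qed.

(** The shifted operators commute, so the concatenation of two annihilating lists kills both
    vectors. *)
Lemma shift_torsion_subspace P : is_subspace (shift_torsion P).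
Proof.
split; first by exists [::].
move=> a u v [cs1 P1 u0] [cs2 P2 v0]; exists (cs1 ++ cs2) => [c|].
  by rewrite mem_cat => /orP[/P1|/P2].
rewrite /shifted_prod foldr_cat -!/(shifted_prod _ _) shifted_prod_linear.
rewrite v0 addr0 -[_ *: _]addr0 shifted_prod_linear shifted_prod_catC u0.
by rewrite !shifted_prod0 scaler0 addr0.
Qed.

(** One step up a filtration: an eigenvector modulo torsion is torsion. *)
Lemma shift_torsion_shift (P : C -> Prop) c v :
  P c -> shift_torsion P (f v - c *: v) -> shift_torsion P v.
Proof.
move=> Pc [cs Pcs vcs]; exists (c :: cs) => [c'|].
  by rewrite inE => /predU1P[->|/Pcs].
by rewrite /= -shifted_prodC.
Qed.

End ShiftedProducts.

Lemma shift_torsion_map (C : fieldType) (V V' : lmodType C) (f : V -> V)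
    (f' : V' -> V') (h : V -> V') (P : C -> Prop) v :
  linear h -> (forall u, h (f u) = f' (h u)) ->
  shift_torsion f P v -> shift_torsion f' P (h v).
Proof.
move=> linh hf [cs Pcs vcs]; exists cs => //.
have hD u w : h (u + w) = h u + h w by rewrite -[u]scale1r linh !scale1r.
have h0 : h 0 = 0 by apply: (addrI (h 0)); rewrite -hD !addr0.
have hZ a u : h (a *: u) = a *: h u by rewrite -[a *: u]addr0 linh h0 addr0.
rewrite -[RHS]h0 -vcs; elim: cs {Pcs vcs} => //= c cs ->.
by rewrite -!scaleNr hD hZ hf.
Qed.

(* A vector killed by E with H-eigenvalue l vanishes in finite dimension as soon
   as no E F^(m+1) u = (m+1)(l - m k/2) F^m u vanishes: the F^m u would have
   pairwise distinct H-eigenvalues. *)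
Lemma sl2_highest_weight_eq0 (C : numFieldType) (d : nat) (E F H : 'M[C]_d)
    (k l : C) (u : 'cV[C]_d) :
  E *m F - F *m E = H -> H *m F - F *m H = - k *: F -> k != 0 ->
  E *m u = 0 -> H *m u = l *: u ->
  (forall m : nat, 2%:R * l != m%:R * k) -> u = 0.
Proof.
move=> EF HF k0 Eu Hu lm.
pose w m := iter m (mulmx F) u.
have Hw m : H *m w m = (l - m%:R * k) *: w m.
  elim: m => [|m IH]; first by rewrite mul0r subr0.
  have HFe : H *m F = F *m H - k *: F by rewrite -scaleNr -HF addrC subrK.
  rewrite /w iterS -/(w m) mulmxA HFe mulmxBl -mulmxA IH -scalemxAr -scalemxAl.
  by rewrite -scalerBl -natr1 mulrDl mul1r opprD addrA.
have Ew m : E *m w m.+1 = (m.+1%:R * (l - m%:R * k / 2%:R)) *: w m.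
  have EFe : E *m F = F *m E + H by rewrite -EF addrC subrK.
  elim: m => [|m IH].
    by rewrite /w /= mulmxA EFe mulmxDl -mulmxA Eu mulmx0 add0r Hu !mul0r subr0 mul1r.
  rewrite /w iterS -/(w m.+1) mulmxA EFe mulmxDl -mulmxA IH Hw -scalemxAr.
  rewrite -[F *m _]/(w m.+1) -scalerDl; congr (_ *: _).
  by field.
apply/eqP/negPn/negP => u0.
have w0 m : w m != 0.
  elim: m => // m; apply: contraNneq => wS.
  have := Ew m; rewrite wS mulmx0 => /esym/eqP; rewrite scaler_eq0 => /orP[|//].
  rewrite mulf_eq0 Num.Theory.pnatr_eq0 /= => /eqP e; have := lm m; case/eqP.
  have -> : 2%:R * l = 2%:R * (l - m%:R * k / 2%:R) + m%:R * k.
    by field.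
  by rewrite e mulr0 add0r.
(* These are [d.+1] distinct roots of a characteristic polynomial of degree [d]. The transposes
   appear because [eigenvalue] refers to row vectors. *)
pose rs := [seq l - m%:R * k | m <- iota 0 d.+1].
have: (size rs < size (char_poly H^T))%N.
  apply: max_poly_roots.
  - exact/monic_neq0/char_poly_monic.
  - apply/allP => _ /mapP[m _ ->]; rewrite -eigenvalue_root_char.
    apply/eigenvalueP; exists (w m)^T; last by rewrite trmx_eq0.
    by rewrite -trmx_mul Hw linearZ.
  - rewrite map_inj_uniq ?iota_uniq // => m m' /addrI/oppr_inj/(mulIf k0)/eqP.
    by rewrite Num.Theory.eqr_nat => /eqP.
by rewrite size_map size_iota size_char_poly ltnn.
Qed.

(** * The orthogonal Lie algebra *)

Section OrthogonalAlgebra.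
Variables (C : fieldType) (N : nat).
Implicit Types i j a c : idx N.

Lemma inv_eq i j : (inv i == j) = (i == inv j).
Proof. by rewrite -{2}(invK i) (inj_eq (inv_inj (@invK N))). Qed.

Lemma F_inv i j : F C (inv j) (inv i) = - F C i j.
Proof. by rewrite /F !invK opprB. Qed.

Lemma F_orth i j : F C i j \in orth C N.
Proof.
apply: (subvP (sumv_sup i _ (sumv_sup j _ (subvv _)))) => //.
exact: memv_line.
Qed.

Lemma orthP A : A \in orth C N ->
  exists a : idx N -> idx N -> C, A = \sum_i \sum_j a i j *: F C i j.
Proof.
case/memv_sumP => u uP ->.
have H i : exists a : idx N -> C, u i = \sum_j a j *: F C i j.
  have /memv_sumP[w wP ->] := uP i isT.
  have H j : exists k, w j = k *: F C i j by apply/vlineP/wP.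
  by have [a aP] := choice H; exists a; apply: eq_bigr.
by have [a aP] := choice H; exists a; apply: eq_bigr.
Qed.

Lemma F_commutator a c i j :
  F C a c *m F C i j - F C i j *m F C a c =
  (c == i)%:R *: F C a j - (j == a)%:R *: F C i c
  - (inv a == i)%:R *: F C (inv c) j + (j == inv c)%:R *: F C i (inv a).
Proof.
have dE p q r s :
    delta_mx p q *m delta_mx r s = (q == r)%:R *: delta_mx p s :> 'M[C]_(N.*2.+1).
  by rewrite mul_delta_mx_cond scaler_nat.
rewrite /F !mulmxBl !mulmxBr !dE !invK.
rewrite !(inj_eq (inv_inj (@invK N))) [inv a == i]inv_eq.
rewrite -(inv_eq c j) [inv c == j]eq_sym [inv i == a]eq_sym [a == j]eq_sym [i == c]eq_sym.
apply/matrixP => p q; rewrite !mxE.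
by ring.
Qed.

End OrthogonalAlgebra.

(** * The three kinds of indices and their order by weight *)

Section Indices.
Variable n : nat.
Implicit Types (i j : idx n) (k l : 'I_n).

Lemma val_pos k : pos k = k.+1 :> nat.
Proof. by rewrite /pos inordK //; have := ltn_ord k; lia. Qed.

Lemma val_inv_pos k : inv (pos k) = (n + k.+1)%N :> nat.
Proof. by rewrite val_inv val_pos /= ltn_ord. Qed.

Lemma pos_inj : injective (@pos n).
Proof. by move=> k l /(congr1 val); rewrite /= !val_pos => -[/val_inj]. Qed.

Lemma inv_ord0 : inv (ord0 : idx n) = ord0.
Proof. by apply: val_inj; rewrite /= val_inv. Qed.

Variant idx_spec i : Prop :=
| IdxZero of i = ord0
| IdxPos k of i = pos k
| IdxNeg k of i = inv (pos k).

Lemma idxP i : idx_spec i.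
Proof.
have [i0|i_gt0] := posnP i; first by apply/IdxZero/val_inj.
have [le_in|lt_ni] := leqP i n.
  have ik : (i.-1 < n)%N by lia.
  by apply: (@IdxPos _ (Ordinal ik)); apply: val_inj; rewrite /= val_pos /=; lia.
have ik : (i - n.+1 < n)%N by have := ltn_ord i; lia.
by apply: (@IdxNeg _ (Ordinal ik)); apply: val_inj; rewrite /= val_inv_pos /=; lia.
Qed.

Lemma pos_neq0 k : (pos k == ord0) = false.
Proof. by apply/eqP => /(congr1 val); rewrite /= val_pos. Qed.

Lemma inv_pos_neq0 k : (inv (pos k) == ord0) = false.
Proof. by apply/eqP => /(congr1 val); rewrite /= val_inv_pos; lia. Qed.

Lemma inv_pos_neq k l : (inv (pos k) == pos l) = false.
Proof.
apply/eqP => /(congr1 val); rewrite /= val_inv_pos val_pos.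
by have := ltn_ord l; lia.
Qed.

(* Position in the order 1, ..., n, 0, n', ..., 1' of decreasing weights. *)
Definition rank i : nat :=
  if i == 0 :> nat then n else if (i <= n)%N then i.-1 else (3 * n + 1 - i)%N.

Lemma rank0 : rank ord0 = n.
Proof. by []. Qed.

Lemma rank_pos k : rank (pos k) = k.
Proof. by rewrite /rank val_pos /= ltn_ord. Qed.

Lemma rank_neg k : rank (inv (pos k)) = (n.*2 - k)%N.
Proof. by have ltk := ltn_ord k; rewrite /rank val_inv_pos !ifF; lia. Qed.

Lemma rank_inj : injective rank.
Proof.
move=> i j; case: (idxP i) => [|k|k] ->; case: (idxP j) => [|l|l] ->;
  rewrite ?rank0 ?rank_pos ?rank_neg // => e.
- by have := ltn_ord l; lia.
- by have := ltn_ord l; lia.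
- by have := ltn_ord k; lia.
- by congr (pos _); apply: val_inj.
- by have := ltn_ord k; have := ltn_ord l; lia.
- by have := ltn_ord k; lia.
- by have := ltn_ord k; have := ltn_ord l; lia.
- by congr (inv (pos _)); apply: val_inj => /=; have := ltn_ord k; have := ltn_ord l; lia.
Qed.

Lemma rank_lt i : (rank i < n.*2.+1)%N.
Proof.
by case: (idxP i) => [|k|k] ->; rewrite ?rank0 ?rank_pos ?rank_neg;
  try have := ltn_ord k; lia.
Qed.

Lemma card_rank_lt t : (t <= n.*2.+1)%N -> #|[pred p : idx n | (rank p < t)%N]| = t.
Proof.
move=> tle; pose o (p : idx n) : idx n := Ordinal (rank_lt p).
have o_inj : injective o by move=> p q /(congr1 val) /rank_inj.
rewrite -sum1_card (eq_bigl (fun p => o p < t)%N) //.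
rewrite -(reindex o (P := fun q : idx n => (q < t)%N) (F := fun=> 1%N)) /=; last first.
  by apply: onW_bij; apply: injF_bij.
by rewrite -(big_ord_widen _ (fun=> 1%N)) // sum1_card card_ord.
Qed.

Lemma rank_lt_inv i : (rank (inv i) < rank i)%N = (n < rank i)%N.
Proof.
by case: (idxP i) => [|k|k] ->; rewrite ?inv_ord0 ?invK ?rank0 ?rank_pos ?rank_neg ?ltnn //;
  have := ltn_ord k; lia.
Qed.

(** This count is the integer shift in the Casimir eigenvalue attached to [i]: with 1-based k it is
    k - 1 at k, n at 0 and 2n - k at k'. *)
Lemma card_rank_lt_neq_inv i :
  #|[pred p : idx n | (rank p < rank i)%N && (p != inv i)]| = (rank i - (n < rank i))%N.
Proof.
have := card_rank_lt (ltnW (rank_lt i)).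
rewrite (cardD1 (inv i)) inE rank_lt_inv => e.
apply/eqP; rewrite -(eqn_add2l (n < rank i)) [X in _ == X]addnC subnK; last first.
  by case: (ltnP n (rank i)) => //; lia.
apply/eqP; rewrite -[RHS]e; congr (_ + _)%N.
by apply: eq_card => p; rewrite !inE andbC.
Qed.

End Indices.

(** * Weights of the natural module, and the generators as root vectors *)

Section Weights.
Variables (C : fieldType) (n : nat).
Implicit Types (i j a c : idx n).

Definition idx_weight a : 'rV[C]_n :=
  \row_k ((a == pos k)%:R - (a == inv (pos k))%:R).

Lemma idx_weight0 : idx_weight ord0 = 0.
Proof.
by apply/rowP => k; rewrite !mxE eq_sym pos_neq0 eq_sym inv_pos_neq0 subrr.
Qed.

Lemma idx_weight_pos k : idx_weight (pos k) = eps C k.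
Proof.
apply/rowP => l; rewrite !mxE eqxx /= (inj_eq (@pos_inj n)).
by rewrite [_ == inv _]eq_sym inv_pos_neq subr0 eq_sym.
Qed.

Lemma idx_weight_neg k : idx_weight (inv (pos k)) = - eps C k.
Proof.
apply/rowP => l; rewrite !mxE eqxx /= (inj_eq (inv_inj (@invK n))) (inj_eq (@pos_inj n)).
by rewrite inv_pos_neq sub0r eq_sym.
Qed.

Lemma F_root_space a c : in_root_space (idx_weight a - idx_weight c) (F C a c).
Proof.
split=> [|k]; first exact: F_orth.
rewrite F_commutator !mxE.
have sub (x y : idx n) (g : idx n -> 'M[C]_(n.*2.+1)) :
    (x == y)%:R *: g x = (x == y)%:R *: g y.
  by case: eqP => [->|]; rewrite ?scale0r.
rewrite (sub _ a (fun x => F C x c)) (sub _ a (fun x => F C x c)).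
rewrite -(sub c _ (F C a)) -(sub c _ (F C a)).
rewrite -!scalerBl -scalerDl [pos k == a]eq_sym [inv _ == a]eq_sym.
by congr (_ *: _); ring.
Qed.

(** Earlier indices have larger weights. The pair a = c' is excluded because it would give 2 eps_k,
    which is not a root; there [F C a c] is zero. *)
Lemma positive_root_rank a c : (rank a < rank c)%N -> a != inv c ->
  positive_root (idx_weight a - idx_weight c).
Proof.
case: (idxP a) => [|k|k] ->; case: (idxP c) => [|l|l] ->;
  rewrite ?rank0 ?rank_pos ?rank_neg ?invK ?ltnn // => lt_ac ne_ac;
  rewrite ?idx_weight0 ?idx_weight_pos ?idx_weight_neg ?opprK ?sub0r ?subr0.
- by have := ltn_ord l; lia.
- by right; exists l; rewrite add0r.
- by right; exists k.
- by left; exists k, l; split=> //; right.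
- have kl : k != l by apply: contraNneq ne_ac => ->.
  have [lt_kl|lt_lk|/val_inj e] := ltngtP k l; last by rewrite e eqxx in kl.
  + by left; exists k, l; split=> //; left.
  + by left; exists l, k; split=> //; left; rewrite addrC.
- by have := ltn_ord k; lia.
- by have := ltn_ord k; have := ltn_ord l; lia.
- left; exists l, k; split; first by have := ltn_ord k; have := ltn_ord l; lia.
  by right; rewrite addrC.
Qed.

End Weights.

(** * The split Casimir operator on (natural module) (x) M *)

Section Representation.
Variables (C : numFieldType) (n d : nat) (rho : 'M[C]_(n.*2.+1) -> 'M[C]_d).
Hypothesis rep : is_rep (orth C n) rho.
Implicit Types (i j a c e : idx n) (z : {ffun idx n -> 'cV[C]_d}).

Lemma rep0 : rho 0 = 0.
Proof.
have := rep.1 (-1) 0 0 (mem0v _) (mem0v _).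
by rewrite scaler0 addr0 scaleN1r addNr.
Qed.

Lemma repD A B : A \in orth C n -> B \in orth C n -> rho (A + B) = rho A + rho B.
Proof. by move=> AL BL; rewrite -[A]scale1r rep.1 // !scale1r. Qed.

Lemma repZ k A : A \in orth C n -> rho (k *: A) = k *: rho A.
Proof. by move=> AL; rewrite -[k *: A]addr0 rep.1 ?mem0v // rep0 addr0. Qed.

Lemma repN A : A \in orth C n -> rho (- A) = - rho A.
Proof. by move=> AL; rewrite -scaleN1r repZ // scaleN1r. Qed.

Lemma repB A B : A \in orth C n -> B \in orth C n -> rho (A - B) = rho A - rho B.
Proof. by move=> AL BL; rewrite repD ?memvN // repN. Qed.

Lemma rep_sum (I : Type) (r : seq I) (A : I -> 'M[C]_(n.*2.+1)) :
  (forall k, A k \in orth C n) -> rho (\sum_(k <- r) A k) = \sum_(k <- r) rho (A k).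
Proof.
move=> AL; elim: r => [|i r IH]; first by rewrite !big_nil rep0.
by rewrite !big_cons repD ?IH // memv_suml.
Qed.

Lemma rep_inv i j : rho (F C (inv j) (inv i)) = - rho (F C i j).
Proof. by rewrite F_inv repN // F_orth. Qed.

Lemma rep_inv_eq0 i : rho (F C i (inv i)) = 0.
Proof. by rewrite /F invK subrr rep0. Qed.

Lemma rep_commutator a c i j :
  rho (F C a c) *m rho (F C i j) - rho (F C i j) *m rho (F C a c) =
  (c == i)%:R *: rho (F C a j) - (j == a)%:R *: rho (F C i c)
  - (inv a == i)%:R *: rho (F C (inv c) j) + (j == inv c)%:R *: rho (F C i (inv a)).
Proof.
rewrite -rep.2 ?F_orth // F_commutator.
have ZF k x y : k *: F C x y \in orth C n by rewrite memvZ ?F_orth.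
rewrite repD ?memvB //.
rewrite (repB (memvB (ZF _ _ _) (ZF _ _ _)) (ZF _ _ _)).
by rewrite (repB (ZF _ _ _) (ZF _ _ _)) !repZ ?F_orth.
Qed.

Lemma orth_stable (S : 'cV[C]_d -> Prop) :
  is_subspace S -> (forall i j v, S v -> S (rho (F C i j) *m v)) ->
  forall A v, A \in orth C n -> S v -> S (rho A *m v).
Proof.
move=> subS SF A v /orthP[a ->] Sv.
rewrite rep_sum => [|i]; last by rewrite memv_suml // => j _; rewrite memvZ ?F_orth.
rewrite mulmx_suml; apply: subspace_sum => // i _.
rewrite rep_sum => [|j]; last by rewrite memvZ ?F_orth.
rewrite mulmx_suml; apply: subspace_sum => // j _.
by rewrite repZ ?F_orth // -scalemxAl; apply: subspaceZ => //; apply: SF.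
Qed.

(* The family (z_i) stands for the tensor sum_i e_i (x) z_i of the natural module
   with C^d; [casimir] is the split Casimir operator
   1/2 sum_(i, j) F_ji (x) F_ij and [diagF a c] the diagonal action of F_ac. *)
Definition casimir z : {ffun idx n -> 'cV[C]_d} :=
  [ffun j => \sum_i rho (F C i j) *m z i].

Definition diagF a c z : {ffun idx n -> 'cV[C]_d} :=
  [ffun j => rho (F C a c) *m z j + (j == a)%:R *: z c
             - (j == inv c)%:R *: z (inv a)].

Definition pure e (v : 'cV[C]_d) : {ffun idx n -> 'cV[C]_d} :=
  [ffun j => (j == e)%:R *: v].

Lemma casimir_linear : linear casimir.
Proof.
move=> k z w; apply/ffunP => j; rewrite !ffunE scaler_sumr -big_split /=.
by apply: eq_bigr => i _; rewrite !ffunE mulmxDr scalemxAr.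
Qed.

Lemma diagF_linear a c : linear (diagF a c).
Proof.
move=> k z w; apply/ffunP => j; rewrite !ffunE mulmxDr -scalemxAr.
move: (rho _ *m z j) (rho _ *m w j) (z c) (w c) (z (inv a)) (w (inv a)) => z1 w1 z2 w2 z3 w3.
by apply/matrixP => p q; rewrite !mxE; ring.
Qed.

(** Invariance of the split Casimir operator. Of the four terms of [F_ac, F_ij], two cancel against
    the natural-module part of [diagF] applied outside [casimir], and two match that part applied
    inside. *)
Lemma casimir_diagF a c z : casimir (diagF a c z) = diagF a c (casimir z).
Proof.
apply/ffunP => j; rewrite !ffunE.
have sub (g : idx n -> 'cV[C]_d) x : \sum_i (i == x)%:R *: g i = g x.
  by rewrite (bigD1 x) //= eqxx scale1r big1 ?addr0 // => i /negPf ->; rewrite scale0r.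
have -> : \sum_i rho (F C i j) *m (diagF a c z) i =
    \sum_i rho (F C i j) *m (rho (F C a c) *m z i)
    + rho (F C a j) *m z c - rho (F C (inv c) j) *m z (inv a).
  rewrite -(sub (fun i => rho (F C i j) *m z c)) -(sub (fun i => rho (F C i j) *m z (inv a))).
  rewrite -big_split -sumrB /=; apply: eq_bigr => i _.
  by rewrite ffunE mulmxBr mulmxDr -!scalemxAr.
have -> : rho (F C a c) *m (\sum_i rho (F C i j) *m z i) =
    \sum_i rho (F C i j) *m (rho (F C a c) *m z i)
    + rho (F C a j) *m z c - (j == a)%:R *: (\sum_i rho (F C i c) *m z i)
    - rho (F C (inv c) j) *m z (inv a)
    + (j == inv c)%:R *: (\sum_i rho (F C i (inv a)) *m z i).
  rewrite -(sub (fun i => rho (F C a j) *m z i)) -(sub (fun i => rho (F C (inv c) j) *m z i)).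
  rewrite !scaler_sumr mulmx_sumr -big_split -!sumrB -big_split /=.
  apply: eq_bigr => i _; rewrite mulmxA.
  have := rep_commutator a c i j => /eqP; rewrite subr_eq => /eqP ->.
  rewrite !(mulmxDl, mulNmx) -!scalemxAl mulmxA [c == i]eq_sym [inv a == i]eq_sym.
  move: (rho (F C i j) *m _ *m _) (rho (F C a j) *m _) (rho (F C i c) *m _).
  move: (rho (F C (inv c) j) *m _) (rho (F C i (inv a)) *m _) => z1 z2 z3 z4 z5.
  by apply/matrixP => p q; rewrite !mxE; ring.
move: (\sum_i _) (\sum_i _) (\sum_i _) (_ *m z c) (_ *m z (inv a)).
by move=> z1 z2 z3 z4 z5; apply/matrixP => p q; rewrite !mxE; ring.
Qed.

End Representation.

(** * Spectrum of the split Casimir operator, starting from a highest weight vector *)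

Section HighestWeight.
Variables (C : numFieldType) (n d : nat) (rho : 'M[C]_(n.*2.+1) -> 'M[C]_d).
Hypothesis rep : is_rep (orth C n) rho.
Variables (mu : 'rV[C]_n) (v : 'cV[C]_d).
Hypothesis hwv : highest_weight_vector mu rho v.
Implicit Types (i j a c e p : idx n) (k l : 'I_n).

Lemma raising_eq0 a c : (rank a < rank c)%N -> rho (F C a c) *m v = 0.
Proof.
move=> lt_ac; have [->|ne_ac] := eqVneq a (inv c).
  by rewrite -{2}(invK c) rep_inv_eq0 // mul0mx.
have [_ _ ev0] := hwv.
exact: ev0 (positive_root_rank C lt_ac ne_ac) (F_root_space C a c).
Qed.

(** The component at j is F_ij v: it vanishes for j after i, where F_ij is raising, and is w v for j
    = i. Each earlier p contributes e_p (x) F_ip v, which is the diagonal action of F_ip on e_p (x)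
    v minus e_i (x) v; these subtractions make up the shift of w. *)
Lemma casimir_pure i (w : C) : rho (F C i i) *m v = w *: v ->
  casimir rho (pure i v) - (w - (rank i - (n < rank i))%:R) *: pure i v =
  \sum_(p | (rank p < rank i)%N && (p != inv i)) diagF rho i p (pure p v).
Proof.
move=> iv; apply/ffunP => j; rewrite !ffunE sum_ffunE.
rewrite (bigD1 i) //= big1 => [|q /negPf qi]; last by rewrite ffunE qi scale0r mulmx0.
rewrite ffunE eqxx scale1r addr0.
under eq_bigr => p /andP[_ pi].
  rewrite !ffunE eqxx scale1r [inv i == p]eq_sym (negPf pi) scale0r scaler0 subr0.
  over.
rewrite big_split /= sumr_const card_rank_lt_neq_inv.
have -> : \sum_(p | (rank p < rank i)%N && (p != inv i))
    rho (F C i p) *m ((j == p)%:R *: v) =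
    if (rank j < rank i)%N then rho (F C i j) *m v else 0.
  have [ltji|geji] := boolP (rank j < rank i)%N; last first.
    rewrite big1 // => p /andP[ltpi _]; case: eqP => [jp|_]; last by rewrite scale0r mulmx0.
    by rewrite jp ltpi in geji.
  have [->|nej] := eqVneq j (inv i).
    rewrite rep_inv_eq0 // mul0mx big1 // => p /andP[_ /negPf].
    by rewrite eq_sym => ->; rewrite scale0r mulmx0.
  rewrite (bigD1 j) ?ltji //= eqxx scale1r big1 ?addr0 // => p /andP[_ /negPf].
  by rewrite eq_sym => ->; rewrite scale0r mulmx0.
have [->|nji] := eqVneq j i.
  by rewrite ltnn iv scale1r add0r scalerBl opprB addrC subrK scaler_nat.
rewrite !scale0r scaler0 subr0 mul0rn addr0; case: ltnP => // leij.
by rewrite raising_eq0 // ltn_neqAle leij andbT (inj_eq (@rank_inj n)) eq_sym.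
Qed.

Lemma weight_pos k : rho (F C (pos k) (pos k)) *m v = mu 0 k *: v.
Proof. by have [_ ->] := hwv. Qed.

Lemma weight_neg k :
  rho (F C (inv (pos k)) (inv (pos k))) *m v = - mu 0 k *: v.
Proof. by rewrite rep_inv // mulNmx weight_pos scaleNr. Qed.

Lemma weight0 : rho (F C ord0 ord0) *m v = 0.
Proof. by rewrite -{2}(inv_ord0 n) rep_inv_eq0 // mul0mx. Qed.

(** In the sl2-triple of eps_k - eps_l the vector v has weight 0, so F_lk v is killed by the raising
    operator and has weight -2, which [sl2_highest_weight_eq0] forbids. *)
Lemma lowering_eq0 k l : (k < l)%N -> mu 0 k = mu 0 l ->
  rho (F C (pos l) (pos k)) *m v = 0.
Proof.
move=> lt_kl mu_kl.
have kl : pos k == pos l = false.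
  by rewrite (inj_eq (@pos_inj n)); apply/eqP => e; rewrite e ltnn in lt_kl.
have lk : pos l == pos k = false by rewrite eq_sym.
have pn x y : pos x == inv (pos y) = false :> bool by rewrite eq_sym inv_pos_neq.
have zE := (kl, lk, inv_pos_neq, pn, eqxx).
set E := rho (F C (pos k) (pos l)); set G := rho (F C (pos l) (pos k)).
set H := rho (F C (pos k) (pos k)) - rho (F C (pos l) (pos l)).
have EG : E *m G - G *m E = H.
  by rewrite rep_commutator // !zE !scale0r !scale1r addr0 subr0.
have HG : H *m G - G *m H = - 2%:R *: G.
  have e1 : rho (F C (pos k) (pos k)) *m G - G *m rho (F C (pos k) (pos k)) = - G.
    by rewrite rep_commutator // !zE !scale0r !scale1r addr0 subr0 sub0r.
  have e2 : rho (F C (pos l) (pos l)) *m G - G *m rho (F C (pos l) (pos l)) = G.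
    by rewrite rep_commutator // !zE !scale0r !scale1r addr0 !subr0.
  rewrite mulmxBl mulmxBr opprD addrACA -opprD e1 e2.
  by rewrite scaleNr scaler_nat mulr2n opprD.
have Hv : H *m v = 0 by rewrite mulmxBl !weight_pos mu_kl subrr.
have Ev : E *m v = 0 by apply: raising_eq0; rewrite !rank_pos.
have Hmu : H *m G = G *m H - 2%:R *: G by rewrite -scaleNr -HG addrC subrK.
apply: (sl2_highest_weight_eq0 (l := - 2%:R) EG HG).
- by rewrite Num.Theory.pnatr_eq0.
- by rewrite mulmxA -[E *m G](subrK (G *m E)) EG mulmxDl Hv -mulmxA Ev mulmx0 addr0.
- by rewrite mulmxA Hmu mulmxBl -mulmxA Hv mulmx0 sub0r -scalemxAl scaleNr.
- move=> m; apply/eqP => e.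
  have : (m.*2 + 4)%:R == 0 :> C.
    by rewrite natrD -muln2 natrM -e mulrN -natrM addNr.
  by rewrite Num.Theory.pnatr_eq0; lia.
Qed.

(** For the short root eps_k, v generates the two-dimensional spin representation. Formally, the
    square of the lowering operator sends v to a vector killed by the raising operator, with
    H-eigenvalue -3/2. *)
Lemma lowering2_eq0 k : k.+1 = n -> mu 0 k = 2%:R^-1 ->
  rho (F C ord0 (pos k)) *m (rho (F C ord0 (pos k)) *m v) = 0.
Proof.
move=> kn mu_k.
have k0 := @pos_neq0 n k.
have kI : ord0 == pos k = false by rewrite eq_sym.
have pn x y : pos x == inv (pos y) = false :> bool by rewrite eq_sym inv_pos_neq.
have zE := (k0, kI, inv_pos_neq0, inv_pos_neq, pn, eqxx, inv_ord0).
set E := rho (F C (pos k) ord0); set G := rho (F C ord0 (pos k)).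
set H := rho (F C (pos k) (pos k)).
have F00 : rho (F C ord0 ord0) = 0 by rewrite -{2}(inv_ord0 n) rep_inv_eq0.
have EG : E *m G - G *m E = H.
  by rewrite rep_commutator // !zE F00 !scale0r !scale1r addr0 !subr0.
have HG : H *m G - G *m H = - 1 *: G.
  by rewrite rep_commutator // !zE !scale0r !scale1r addr0 subr0 sub0r scaleN1r.
have Hv : H *m v = 2%:R^-1 *: v by rewrite weight_pos mu_k.
have Ev : E *m v = 0 by apply: raising_eq0; rewrite rank_pos rank0 -{2}kn.
have HGE : H *m G = G *m H - G by rewrite -scaleN1r -HG addrC subrK.
have EGE : E *m G = G *m E + H by rewrite -EG addrC subrK.
have half : 2%:R^-1 - 1 = - 2%:R^-1 :> C by field.
have HGv : H *m (G *m v) = - 2%:R^-1 *: (G *m v).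
  by rewrite mulmxA HGE mulmxBl -mulmxA Hv -scalemxAr -{2}[G *m v]scale1r -scalerBl half.
apply: (sl2_highest_weight_eq0 (l := - 2%:R^-1 - 1) EG HG).
- exact: oner_neq0.
- rewrite mulmxA EGE mulmxDl HGv -mulmxA [E *m _]mulmxA EGE mulmxDl -mulmxA Ev.
  by rewrite mulmx0 add0r Hv -scalemxAr scaleNr subrr.
- by rewrite mulmxA HGE mulmxBl -mulmxA HGv -scalemxAr -{2}[G *m (G *m v)]scale1r -scalerBl.
- move=> m; apply/eqP => e.
  have : (m + 3)%:R == 0 :> C.
    by rewrite natrD -[m%:R]mulr1 -e; apply/eqP; field.
  by rewrite Num.Theory.pnatr_eq0; lia.
Qed.

Variable P : C -> Prop.
Let torsion := shift_torsion (casimir rho) P.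

Let torsion_sub : is_subspace torsion.
Proof. exact/shift_torsion_subspace/casimir_linear. Qed.

Lemma torsion_diagF a c z : torsion z -> torsion (diagF rho a c z).
Proof.
apply: shift_torsion_map; first exact: diagF_linear.
by move=> u; rewrite casimir_diagF.
Qed.

Lemma torsion_step i w : rho (F C i i) *m v = w *: v ->
  P (w - (rank i - (n < rank i))%:R) ->
  (forall p, (rank p < rank i)%N -> torsion (pure p v)) -> torsion (pure i v).
Proof.
move=> iv Pc IH; apply: shift_torsion_shift Pc _; first exact: casimir_linear.
rewrite casimir_pure //; apply: subspace_sum => // p /andP[ltpi _].
exact/torsion_diagF/IH.
Qed.

(** [P] must contain the eigenvalues met at k, 0 and k'. The last two cases of [Pneg] are those
    where lowering operators reach e_k' (x) v from earlier vectors, without a new eigenvalue. *)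
Hypothesis Ppos : forall k, P (mu 0 k - k%:R).
Hypothesis Pzero : P (- n%:R).
Hypothesis Pneg : forall k,
  [\/ P (- mu 0 k - (n.*2 - k.+1)%:R),
      exists2 l : 'I_n, l = k.+1 :> nat & mu 0 k = mu 0 l
    | k.+1 = n /\ mu 0 k = 2%:R^-1].

Lemma torsion_pure i : torsion (pure i v).
Proof.
have [r ltir] := ubnP (rank i); elim: r i ltir => // r IHr i lti.
have IH p : (rank p < rank i)%N -> torsion (pure p v).
  by move=> ltpi; apply: IHr; apply: leq_trans ltpi _.
case: (idxP i) lti IH => [|k|k] -> lti IH.
- apply: (torsion_step (w := 0)) => //; first by rewrite weight0 scale0r.
  by rewrite rank0 ltnn subn0 sub0r.
- apply: (torsion_step (weight_pos k)) => //.
  by rewrite rank_pos ltnNge (ltnW (ltn_ord k)) subn0.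
have ltk := ltn_ord k.
have [Pk|[l lk mu_kl]|[kn mu_k]] := Pneg k.
- apply: (torsion_step (weight_neg k)) => //.
  by rewrite rank_neg; move: Pk; congr (P (_ - _%:R)); lia.
- have ltkl : (k < l)%N by rewrite lk.
  (* F_lk sends e_l' to -e_k' and kills v. *)
  have -> : pure (inv (pos k)) v =
      - diagF rho (pos l) (pos k) (pure (inv (pos l)) v).
    apply/ffunP => j; rewrite !ffunE eqxx scale1r [pos k == _]eq_sym inv_pos_neq.
    by rewrite scale0r scaler0 addr0 -scalemxAr lowering_eq0 // scaler0 sub0r opprK.
  apply: subspaceN => //; apply: torsion_diagF; apply: IH.
  by rewrite !rank_neg; have := ltn_ord l; lia.
- set f := diagF rho ord0 (pos k).
  (* F_0k sends e_k to e_0 and e_0 to -e_k'. As its square kills v, f(f(e_k (x) v)) = -e_k' (x) v +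
     2 e_0 (x) F_0k v, while f(e_0 (x) v) = -e_k' (x) v + e_0 (x) F_0k v. *)
  have -> : pure (inv (pos k)) v = f (f (pure (pos k) v)) - 2%:R *: f (pure ord0 v).
    apply/ffunP => j; rewrite !ffunE inv_ord0 !eqxx [ord0 == pos k]eq_sym pos_neq0.
    rewrite [ord0 == inv _]eq_sym [pos k == inv _]eq_sym inv_pos_neq inv_pos_neq0.
    rewrite !(scale0r, scale1r, scaler0, mulmx0, subr0, addr0, add0r).
    rewrite mulmxDr -!scalemxAr lowering2_eq0 // scaler0 add0r.
    move: (rho _ *m v) => u; rewrite scalerBr -[2%:R]/(1 + 1) !scalerDl !scale1r.
    by rewrite opprB opprD addrACA; apply/matrixP => p q; rewrite !mxE; ring.
  have lt0 : (rank (ord0 : idx n) < rank (inv (pos k)))%N by rewrite rank0 rank_neg; lia.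
  have ltp : (rank (pos k) < rank (inv (pos k)))%N by rewrite rank_pos rank_neg; lia.
  apply: subspaceB => //; first by do 2!apply: torsion_diagF; apply: IH.
  by apply: subspaceZ => //; apply: torsion_diagF; apply: IH.
Qed.

Hypothesis irr : irreducible_module (orth C n) (fun A (u : 'cV[C]_d) => rho A *m u).

(** By the product rule for [diagF], the u with every e_i (x) u torsion form a submodule; it
    contains v, hence is everything. *)
Lemma torsion_all z : torsion z.
Proof.
pose S (u : 'cV[C]_d) := forall e, torsion (pure e u).
have subS : is_subspace S.
  split=> [e|x u w Su Sw e].
    rewrite (_ : pure e 0 = 0); first exact: torsion_sub.1.
    by apply/ffunP => j; rewrite !ffunE scaler0.
  rewrite (_ : pure e _ = x *: pure e u + pure e w); first exact: torsion_sub.2.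
  by apply/ffunP => j; rewrite !ffunE scalerDr !scalerA mulrC.
have SF a c u : S u -> S (rho (F C a c) *m u).
  move=> Su e.
  have -> : pure e (rho (F C a c) *m u) = diagF rho a c (pure e u)
      - (c == e)%:R *: pure a u + (inv a == e)%:R *: pure (inv c) u.
    apply/ffunP => j; rewrite !ffunE -scalemxAr; move: (rho _ *m u) => w.
    by apply/matrixP => p q; rewrite !mxE; ring.
  apply: subspaceD => //; last exact: subspaceZ.
  by apply: subspaceB => //; [exact: torsion_diagF|exact: subspaceZ].
have [_ /(_ S subS)] := irr; case=> [A u AL Su|S0|SV].
  exact: (orth_stable rep subS SF).
- have [v0 _ _] := hwv; case: v0; apply: S0 => e; exact: torsion_pure.
rewrite (_ : z = \sum_e pure e (z e)).
  by apply: subspace_sum => // e _; apply: SV.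
apply/ffunP => j; rewrite sum_ffunE (bigD1 j) //= ffunE eqxx scale1r big1 ?addr0 //.
by move=> e /negPf ej; rewrite ffunE eq_sym ej scale0r.
Qed.

End HighestWeight.

(** * The big matrix operator on the conformal module *)

Lemma big_idx (V : nmodType) (n : nat) (f : idx n -> V) :
  \sum_i f i = f ord0 + \sum_k f (pos k) + \sum_k f (inv (pos k)).
Proof.
rewrite big_ord_recl -addrA; congr (_ + _).
have -> : \sum_(i < n.*2) f (lift ord0 i) = \sum_(0 <= i < n.*2) f (inord i.+1).
  rewrite big_mkord; apply: eq_bigr => i _; congr f; apply: val_inj.
  by rewrite /= inordK ?ltnS.
rewrite (big_cat_nat _ (n := n)) //= -?addnn ?leq_addr //; congr (_ + _).
  by rewrite big_mkord.
rewrite -[X in \sum_(X <= _ < _) _]add0n big_addn -{1}addnn addnK big_mkord.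
apply: eq_bigr => k _; congr f.
apply: val_inj; rewrite /= val_inv_pos inordK; first by lia.
by have := ltn_ord k; lia.
Qed.

(** * Derivatives, the quadratic form [eta] and the Euler operator *)

Section Polynomials.
Variables (C : numFieldType) (n : nat).
Local Notation A := (polA C n).
Implicit Types (i j : idx n) (g t : A).

Lemma mderivXi i j : ('X_i : A)^`M(j) = (i == j)%:R.
Proof.
rewrite mderivX mnm1E; case: eqVneq => [->|_]; last by rewrite scale0r.
by rewrite scale1r (_ : _ - _ = 0)%MM ?mpolyX0 //; apply/mnmP => k; rewrite mnmBE subnn mnm0E.
Qed.

Lemma sum_Xinv : \sum_j 'X_j * 'X_(inv j) = 2%:R *: eta C n.
Proof.
rewrite big_idx inv_ord0 /eta scalerDr scalerA mulfV ?Num.Theory.pnatr_eq0 // scale1r.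
rewrite -addrA; congr (_ + _); rewrite scaler_nat mulr2n; congr (_ + _).
by apply: eq_bigr => k _; rewrite invK mulrC.
Qed.

Lemma sum_eq_idx (f : idx n -> A) j : \sum_i (i == j)%:R * f i = f j.
Proof. by rewrite (bigD1 j) //= eqxx mul1r big1 ?addr0 // => i /negPf ->; rewrite mul0r. Qed.

Lemma mderiv_eta j : (eta C n)^`M(j) = 'X_(inv j).
Proof.
rewrite -(sum_eq_idx (fun i => 'X_(inv i)) j) big_idx /eta linearD /= mderivZ mderivM.
rewrite !mderivXi inv_ord0 mulrC -mulr2n -scaler_nat scalerA mulVf ?Num.Theory.pnatr_eq0 //.
rewrite scale1r -addrA mulrC; congr (_ + _).
rewrite linear_sum -big_split /=; apply: eq_bigr => k _.
by rewrite mderivM !mderivXi invK [X in _ + X]mulrC.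
Qed.

Lemma opD_monomial m : opD ('X_[m] : A) = (mdeg m)%:R *: 'X_[m].
Proof.
rewrite /opD mdegE natr_sum scaler_suml; apply: eq_bigr => i _.
rewrite mderivX -scalerAr -mpolyXD.
have [mi0|mi_gt0] := posnP (m i); first by rewrite mi0 !scale0r.
congr (_ *: 'X_[_]); apply/mnmP => j; rewrite mnmDE mnmBE mnm1E.
by case: eqVneq => [<-|_] /=; lia.
Qed.

End Polynomials.

Section BigOperator.
Variables (C : numFieldType) (n d : nat) (rho : 'M[C]_(n.*2.+1) -> 'M[C]_d).
Variable b : C.
Hypothesis rep : is_rep (orth C n) rho.
Local Notation M := (Mhat C n d).
Implicit Types (i j p : idx n) (w : M).

(* [bigA] is the matrix (Fhat_rs) acting on the tensor product of the natural
   o(2n+3)-module with the conformal module; a triple (y_+, (y_i), y_-) lists the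
   components along e_(n+1), the e_(kappa i) and e_(2n+2). *)
Definition triple : lmodType C := (M * {ffun idx n -> M} * M)%type.

Definition bigA (y : triple) : triple :=
  ( - actD b y.1.1 - \sum_i actJ rho b i (y.1.2 i),
    [ffun j => actP j y.1.1 + \sum_i actL rho i j (y.1.2 i) + actJ rho b (inv j) y.2],
    actD b y.2 - \sum_i actP (inv i) (y.1.2 i)).

(* Coordinates in which [bigA] is block triangular: they come from the
   trivialisation by exp (sum_i x_i d_i). *)
Definition ell (y : triple) : M :=
  [ffun k => y.1.1 k + \sum_j 'X_j * y.1.2 j k - eta C n * y.2 k].

Definition mid (y : triple) : {ffun idx n -> M} :=
  [ffun j => [ffun k => y.1.2 j k - 'X_(inv j) * y.2 k]].

Definition casimirA (z : {ffun idx n -> M}) : {ffun idx n -> M} :=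
  [ffun j => \sum_i tensr (rho (F C i j)) (z i)].

Lemma fun_ffunD (w w' : M) k : (w + w') k = w k + w' k.
Proof. by rewrite ffunE. Qed.

Lemma fun_ffunN w k : (- w) k = - w k.
Proof. by rewrite ffunE. Qed.

Lemma fun_ffunZ (x : C) w k : (x *: w) k = x *: w k.
Proof. by rewrite ffunE. Qed.

Lemma actJE i w k : actJ rho b i w k =
  'X_i * opD (w k) - eta C n * (w k)^`M(inv i) + b%:MP * ('X_i * w k)
  + \sum_p 'X_p * tensr (rho (F C i p)) w k.
Proof.
rewrite !ffunE sum_ffunE mul_mpolyC; congr (_ + _).
by apply: eq_bigr => p _; rewrite ffunE.
Qed.

Lemma actLE i j w k : actL rho i j w k =
  'X_i * (w k)^`M(j) - 'X_(inv j) * (w k)^`M(inv i) + tensr (rho (F C i j)) w k.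
Proof. by rewrite !ffunE. Qed.

Lemma actDE w k : actD b w k = opD (w k) + b%:MP * w k.
Proof. by rewrite !ffunE mul_mpolyC. Qed.

Lemma actPE i w k : actP i w k = (w k)^`M(i).
Proof. by rewrite !ffunE. Qed.

Lemma tensr_inv i j w : tensr (rho (F C (inv j) (inv i))) w = - tensr (rho (F C i j)) w.
Proof.
apply/ffunP => k; rewrite !ffunE rep_inv // -sumrN.
by apply: eq_bigr => l _; rewrite mxE scaleNr.
Qed.

(** Since the x_j x_j' sum to 2 [eta], contracting L_ij with x_j gives the terms of J_i, except for
    one more [eta] times the derivative along i' and no b-term. *)
Lemma sum_X_actL i w k : \sum_j 'X_j * actL rho i j w k =
  actJ rho b i w k - eta C n * (w k)^`M(inv i) - b%:MP * ('X_i * w k).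
Proof.
under eq_bigr => j _ do rewrite actLE mulrDr mulrBr mulrCA [X in _ - X]mulrA.
rewrite big_split sumrB /= -mulr_sumr -mulr_suml sum_Xinv -mul_mpolyC actJE /opD.
rewrite (_ : (2%:R : C)%:MP = 2%:R); last by rewrite rmorph_nat.
by ring.
Qed.

Lemma sum_X_actJ w k : \sum_j 'X_j * actJ rho b (inv j) w k =
  eta C n * actD b w k + b%:MP * (eta C n * w k).
Proof.
under eq_bigr => j _ do rewrite actJE invK !mulrDr mulrN.
rewrite !big_split /= sumrN.
have -> : \sum_j 'X_j * \sum_p 'X_p * tensr (rho (F C (inv j) p)) w k = 0.
  (* The coefficients x_j x_p are symmetric, whereas F_(j',p) = -F_(p',j). *)
  set s := \sum_j _; suff: s = - s.
    move/eqP; rewrite -subr_eq0 opprK -mulr2n -scaler_nat scaler_eq0.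
    by rewrite Num.Theory.pnatr_eq0 => /eqP.
  rewrite {1}/s; under eq_bigr => j _ do rewrite mulr_sumr.
  rewrite exchange_big /= -sumrN; apply: eq_bigr => p _.
  rewrite mulr_sumr -sumrN; apply: eq_bigr => j _.
  have -> : tensr (rho (F C (inv j) p)) w = - tensr (rho (F C (inv p) j)) w.
    by rewrite -tensr_inv invK.
  by rewrite ffunE mulrCA !mulrN.
rewrite addr0 actDE.
under eq_bigr => j _ do rewrite mulrA.
under [X in _ - X + _]eq_bigr => j _ do rewrite mulrCA.
under [X in _ + X]eq_bigr => j _ do rewrite mulrCA [X in _ * X]mulrA.
rewrite -!(mulr_sumr, mulr_suml) sum_Xinv -mul_mpolyC -/(opD (w k)).
rewrite (_ : (2%:R : C)%:MP = 2%:R); last by rewrite rmorph_nat.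
by ring.
Qed.

(** The J-terms of the first component cancel those of the contracted L_ij, and all Euler and
    derivative terms cancel; only the b-terms survive. *)
Lemma ell_bigA y : ell (bigA y) = - b *: ell y.
Proof.
apply/ffunP => k; rewrite !ffunE !sum_ffunE /= -!mul_mpolyC.
have -> : \sum_j 'X_j * ([ffun j => actP j y.1.1 + \sum_i actL rho i j (y.1.2 i)
      + actJ rho b (inv j) y.2] : {ffun idx n -> M}) j k =
    opD (y.1.1 k) + \sum_i \sum_j 'X_j * actL rho i j (y.1.2 i) k
    + \sum_j 'X_j * actJ rho b (inv j) y.2 k.
  rewrite [X in _ = _ + X + _]exchange_big /opD -!big_split /=; apply: eq_bigr => j _.
  rewrite ffunE 2!fun_ffunD sum_ffunE actPE 2!mulrDr.
  by congr (_ + _ + _); rewrite mulr_sumr.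
rewrite (eq_bigr _ (fun i _ => sum_X_actL i (y.1.2 i) k)).
rewrite sum_X_actJ !sumrB !actDE.
under [X in _ - eta C n * (_ - X)]eq_bigr => i _ do rewrite actPE.
rewrite -!mulr_sumr.
set s1 := \sum_i _; set s2 := \sum_i _; set s3 := \sum_i _.
by ring.
Qed.

Lemma ellE y k : ell y k = y.1.1 k + \sum_j 'X_j * y.1.2 j k - eta C n * y.2 k.
Proof. by rewrite ffunE. Qed.

Lemma midE y j k : mid y j k = y.1.2 j k - 'X_(inv j) * y.2 k.
Proof. by rewrite !ffunE. Qed.

Lemma bigA_midE y j k : (bigA y).1.2 j k =
  actP j y.1.1 k + \sum_i actL rho i j (y.1.2 i) k + actJ rho b (inv j) y.2 k.
Proof.
have -> : (bigA y).1.2 j = actP j y.1.1 + \sum_i actL rho i j (y.1.2 i)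
  + actJ rho b (inv j) y.2 by rewrite ffunE.
by rewrite 2!fun_ffunD sum_ffunE.
Qed.

Lemma bigA_minusE y k : (bigA y).2 k =
  actD b y.2 k - \sum_i actP (inv i) (y.1.2 i) k.
Proof. by rewrite fun_ffunD [X in _ + X]ffunE sum_ffunE. Qed.

(** On the kernel of [ell], y_+ is [eta] y_- minus the sum of the x_i y_i. Its derivative along j
    contains x_j' y_- - y_j, which is the summand [- mid y]. *)
Lemma mid_bigA y : ell y = 0 -> mid (bigA y) = casimirA (mid y) - mid y.
Proof.
move=> ly; have y1 k : y.1.1 k = eta C n * y.2 k - \sum_i 'X_i * y.1.2 i k.
  have e : ell y k = 0 by rewrite ly ffunE.
  by rewrite ffunE in e; apply/eqP; rewrite -subr_eq0 -[X in _ == X]e; apply/eqP; ring.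
apply/ffunP => j; apply/ffunP => k.
have -> : mid (bigA y) j k =
    actP j y.1.1 k + \sum_i actL rho i j (y.1.2 i) k + actJ rho b (inv j) y.2 k
    - 'X_(inv j) * (actD b y.2 k - \sum_i actP (inv i) (y.1.2 i) k).
  by rewrite midE bigA_midE bigA_minusE.
have -> : (casimirA (mid y) - mid y) j k =
    \sum_i tensr (rho (F C i j)) (y.1.2 i) k
    + \sum_p 'X_p * tensr (rho (F C (inv j) p)) y.2 k
    - (y.1.2 j k - 'X_(inv j) * y.2 k).
  have -> : (casimirA (mid y) - mid y) j k = casimirA (mid y) j k - mid y j k.
    by rewrite ffunE fun_ffunD; congr (_ + _); rewrite ffunE [LHS]ffunE.
  have -> : casimirA (mid y) j k = \sum_i tensr (rho (F C i j)) (mid y i) k.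
    by rewrite ffunE sum_ffunE.
  rewrite midE; congr (_ - _).
  rewrite [X in _ + X](reindex_inj (inv_inj (@invK n))) -big_split /=.
  apply: eq_bigr => i _.
  have -> : tensr (rho (F C (inv j) (inv i))) y.2 k = - tensr (rho (F C i j)) y.2 k.
    by rewrite tensr_inv ffunE.
  rewrite !ffunE mulrN mulr_sumr -sumrB; apply: eq_bigr => l _.
  by rewrite ?ffunE scalerBr -scalerAr.
have -> : actP j y.1.1 k = 'X_(inv j) * y.2 k + eta C n * (y.2 k)^`M(j)
    - (y.1.2 j k + \sum_i 'X_i * (y.1.2 i k)^`M(j)).
  rewrite actPE y1 mderivB mderivM mderiv_eta [mderiv _ (bigop _ _ _)]linear_sum /=.
  congr (_ - _).
  rewrite -(sum_eq_idx (fun i => y.1.2 i k) j) -big_split /=; apply: eq_bigr => i _.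
  by rewrite mderivM mderivXi.
rewrite actJE actDE invK.
under [X in _ + X + _ - _]eq_bigr => i _ do rewrite actLE.
under [X in _ * (_ - X)]eq_bigr => i _ do rewrite actPE.
rewrite big_split sumrB /= -mulr_sumr.
set s1 := \sum_i _; set s2 := \sum_i _; set s3 := \sum_i _; set s4 := \sum_i _.
by ring.
Qed.

Lemma ell_sub (x : C) (u w : triple) : ell (u - x *: w) = ell u - x *: ell w.
Proof.
have e1 k : (u - x *: w).1.1 k = u.1.1 k - x%:MP * w.1.1 k.
  by rewrite fun_ffunD fun_ffunN fun_ffunZ mul_mpolyC.
have e2 k : (u - x *: w).2 k = u.2 k - x%:MP * w.2 k.
  by rewrite fun_ffunD fun_ffunN fun_ffunZ mul_mpolyC.
  apply/ffunP => k.
  have -> : (ell u - x *: ell w) k = ell u k - x%:MP * ell w k.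
    by rewrite fun_ffunD fun_ffunN fun_ffunZ mul_mpolyC.
  rewrite !ellE.
  have -> : \sum_j 'X_j * (u - x *: w).1.2 j k =
      \sum_j 'X_j * u.1.2 j k - x%:MP * \sum_j 'X_j * w.1.2 j k.
    rewrite mulr_sumr -sumrB; apply: eq_bigr => j _.
    have -> : (u - x *: w).1.2 j k = u.1.2 j k - x%:MP * w.1.2 j k.
      by rewrite ffunE fun_ffunD ffunE fun_ffunN ffunE fun_ffunZ mul_mpolyC.
    by rewrite mulrBr mulrCA.
  rewrite e1 e2; move: (u.1.1 k) (w.1.1 k) (u.2 k) (w.2 k) (\sum_j _) (\sum_j _).
  by move=> u1 w1 u2 w2 u3 w3; ring.
Qed.

Lemma mid_sub (x : C) (u w : triple) : mid (u - x *: w) = mid u - x *: mid w.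
Proof.
have e2 k : (u - x *: w).2 k = u.2 k - x%:MP * w.2 k.
  by rewrite fun_ffunD fun_ffunN fun_ffunZ mul_mpolyC.
  apply/ffunP => j; apply/ffunP => k.
  have -> : (mid u - x *: mid w) j k = mid u j k - x%:MP * mid w j k.
    rewrite ffunE fun_ffunD mul_mpolyC; congr (_ + _).
    by rewrite ffunE fun_ffunN ffunE fun_ffunZ.
  rewrite !midE.
  have -> : (u - x *: w).1.2 j k = u.1.2 j k - x%:MP * w.1.2 j k.
    by rewrite ffunE fun_ffunD ffunE fun_ffunN ffunE fun_ffunZ mul_mpolyC.
  rewrite e2; move: (u.1.2 j k) (w.1.2 j k) (u.2 k) (w.2 k) => u1 w1 u2 w2.
  by ring.
Qed.

(** Here y_j = x_j' y_-, so y is determined by y_-; the 2n+1 derivatives of x_j' along j' turn b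
    into b - 2n - 1. The whole difference vanishes; its first component is what is needed. *)
Lemma bigA_killed y : ell y = 0 -> mid y = 0 ->
  (bigA y - (b - (n.*2.+1)%:R) *: y).1.1 = 0.
Proof.
move=> ly my; set c := b - _; set y' := bigA y - c *: y.
have y1 j k : y.1.2 j k = 'X_(inv j) * y.2 k.
  have /(congr1 (fun w : {ffun idx n -> M} => w j k)) := my.
  by rewrite !ffunE => /eqP; rewrite subr_eq0 => /eqP.
have y'3 : y'.2 = 0.
  apply/ffunP => k.
  have -> : y'.2 k = opD (y.2 k) + b%:MP * y.2 k
      - \sum_i (y.1.2 i k)^`M(inv i) - c%:MP * y.2 k.
    by rewrite !ffunE sum_ffunE -!mul_mpolyC; under eq_bigr => i _ do rewrite actPE.
  under eq_bigr => i _ do rewrite y1 mderivM mderivXi eqxx mul1r.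
  have opDE : \sum_i 'X_(inv i) * (y.2 k)^`M(inv i) = opD (y.2 k).
    by rewrite /opD [RHS](reindex_inj (inv_inj (@invK n))).
  rewrite big_split /= sumr_const card_ord opDE [RHS]ffunE /c rmorphB /= rmorph_nat.
  by rewrite -mulr_natl; ring.
have y'2 : y'.1.2 = 0.
  have: mid y' = 0 by rewrite mid_sub mid_bigA // my scaler0 !subr0; apply/ffunP => j;
    rewrite !ffunE big1 // => i _; apply/ffunP => k; rewrite !ffunE big1 // => l _;
    rewrite !ffunE scaler0.
  move=> my'; apply/ffunP => j; apply/ffunP => k.
  have /(congr1 (fun w : {ffun idx n -> M} => w j k)) := my'.
  by rewrite midE y'3 !ffunE mulr0 subr0.
have: ell y' = 0 by rewrite ell_sub ell_bigA ly !scaler0 subr0.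
move=> ly'; apply/ffunP => k; have /(congr1 (fun w : M => w k)) := ly'.
have f0 : (0 : M) k = 0 by rewrite ffunE.
rewrite ellE y'3 y'2 !f0 mulr0 subr0 big1 ?addr0 // => j _.
by rewrite ffunE f0 mulr0.
Qed.

Lemma casimirA_linear : linear casimirA.
Proof.
move=> x z w; apply/ffunP => j; apply/ffunP => k; rewrite !ffunE !sum_ffunE.
rewrite scaler_sumr -big_split; apply: eq_bigr => i _.
rewrite !ffunE scaler_sumr -big_split; apply: eq_bigr => l _.
by rewrite !ffunE scalerDr !scalerA mulrC.
Qed.

Lemma tens_linear (g : polA C n) : linear (fun v : 'cV[C]_d => tens g v).
Proof.
by move=> x v w; apply/ffunP => k; rewrite !ffunE !mxE scalerDl scalerA.
Qed.

Lemma tens_sum w : w = \sum_k tens (w k) (delta_mx k 0).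
Proof.
apply/ffunP => k; rewrite sum_ffunE (bigD1 k) //= ffunE !mxE !eqxx scale1r.
by rewrite big1 ?addr0 // => l /negPf lk; rewrite ffunE !mxE eq_sym lk scale0r.
Qed.

(** For fixed g, tensoring with g intertwines [casimir] and [casimirA], and the images for all g
    span. *)
Lemma torsionA (P : C -> Prop) (z : {ffun idx n -> M}) :
  (forall z0, shift_torsion (casimir rho) P z0) -> shift_torsion casimirA P z.
Proof.
move=> tors; set T := shift_torsion _ _.
have subT : is_subspace T by apply/shift_torsion_subspace/casimirA_linear.
have Ttens g (z0 : {ffun idx n -> 'cV[C]_d}) : T [ffun j => tens g (z0 j)].
  apply: (shift_torsion_map (h := fun z0 : {ffun idx n -> 'cV[C]_d} =>
    [ffun j => tens g (z0 j)] : {ffun idx n -> M})) (tors z0).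
    by move=> x u w; apply/ffunP => j; rewrite !ffunE tens_linear.
  move=> u; apply/ffunP => j; rewrite !ffunE.
  have tens0 : tens g (0 : 'cV[C]_d) = 0 by apply/ffunP => k; rewrite !ffunE mxE scale0r.
  have tensD : {morph (fun v : 'cV[C]_d => tens g v) : u v / u + v}.
    by move=> v w; rewrite -[v]scale1r tens_linear !scale1r.
  rewrite (big_morph _ tensD tens0); apply: eq_bigr => i _.
  by rewrite ffunE tensr_tens.
have -> : z = \sum_e \sum_k [ffun j => tens (z e k) (pure e (delta_mx k 0) j)].
  apply/ffunP => j; rewrite sum_ffunE (bigD1 j) //= [X in _ + X]big1 => [|e /negPf ej].
    rewrite addr0 sum_ffunE {1}[z j]tens_sum; apply: eq_bigr => k _.
    by rewrite !ffunE eqxx scale1r.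
  rewrite sum_ffunE big1 // => k _; rewrite !ffunE eq_sym ej scale0r.
  by apply/ffunP => l; rewrite !ffunE mxE scale0r.
by apply: subspace_sum => // e _; apply: subspace_sum => // k _; apply: Ttens.
Qed.

End BigOperator.

(** * Submodules of the conformal module *)

Section Submodules.
Variables (C : numFieldType) (n d : nat) (rho : 'M[C]_(n.*2.+1) -> 'M[C]_d).
Variable b : C.
Hypothesis rep : is_rep (orth C n) rho.
Hypothesis irr : irreducible_module (orth C n) (fun A (u : 'cV[C]_d) => rho A *m u).
Local Notation M := (Mhat C n d).
Variable W : M -> Prop.
Hypothesis subW : is_subspace W.
Hypothesis WD : forall w, W w -> W (actD b w).
Hypothesis WP : forall i w, W w -> W (actP i w).
Hypothesis WJ : forall i w, W w -> W (actJ rho b i w).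
Hypothesis WL : forall i j w, W w -> W (actL rho i j w).
Implicit Types (i j : idx n) (w : M) (u : 'cV[C]_d).

Lemma nonzero_constant w : W w -> w <> 0 -> exists2 u, u <> 0 & W (tens 1 u).
Proof.
have [s] : exists s, forall k m, (s < mdeg m)%N -> (w k)@_m = 0.
  exists (\max_k msize (w k))%N => k m ltm; apply/memN_msupp_eq0/msize_mdeg_ge.
  exact: leq_trans (leq_bigmax k) (ltnW ltm).
elim: s w => [|s IHs] w ws Ww w0.
  have we : w = tens 1 (\col_k (w k)@_0).
    apply/ffunP => k; apply/mpolyP => m; rewrite !ffunE mxE mcoeffZ mcoeff1.
    have [->|m0] := eqVneq m 0%MM; first by rewrite mulr1.
    by rewrite mulr0 ws // lt0n mdeg_eq0.
  exists (\col_k (w k)@_0); last by rewrite -we.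
  by move=> u0; apply: w0; rewrite we u0; apply/ffunP => k; rewrite !ffunE mxE scale0r.
(* If all derivatives vanish, then so do the coefficients of degree [s.+1], by characteristic 0;
   otherwise a nonzero derivative has smaller degree. Either way the bound drops. *)
have [Pw0|[i Pwi]] : (forall i, actP i w = 0) \/ exists i, actP i w <> 0.
  have [H|H] := pselect (exists i, actP i w <> 0); first by right.
  by left=> i; apply: contrapT => Pi; apply: H; exists i.
  apply: (IHs w) => // k m; rewrite leq_eqVlt => /orP[/eqP sm|]; last exact: ws.
  have [i mi] : exists i, m i != 0%N.
    apply/existsP; apply: contraPT sm => /existsPn m0.
    suff -> : m = 0%MM by rewrite mdeg0.
    by apply/mnmP => i; rewrite mnm0E; apply/eqP; rewrite -[_ == _]negbK m0.
  have /(congr1 (fun f : M => (f k)@_(m - U_(i)))) := Pw0 i.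
  rewrite !ffunE mcoeff0 mcoeff_deriv submK; last by rewrite lep1mP.
  by move/eqP; rewrite -mulr_natr mulf_eq0 Num.Theory.pnatr_eq0 orbF => /eqP.
apply: IHs (WP i Ww) Pwi => k m sm.
by rewrite ffunE mcoeff_deriv ws ?mul0rn // mdegD mdeg1 addn1.
Qed.

(** On constants L_ij acts through F_ij alone, so the u with 1 (x) u in [W] form a submodule of the
    irreducible module. *)
Lemma constants_mem w : W w -> w <> 0 -> forall u, W (tens 1 u).
Proof.
move=> Ww /(nonzero_constant Ww)[u0 u0N0 Wu0].
pose S u := W (tens 1 u).
have subS : is_subspace S.
  split=> [|x u v Su Sv].
    rewrite /S (_ : tens 1 0 = 0); first exact: subW.1.
    by apply/ffunP => k; rewrite !ffunE mxE scale0r.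
  by rewrite /S tens_linear; apply: subW.2.
have SF i j u : S u -> S (rho (F C i j) *m u).
  move=> Su; have := WL i j Su; rewrite actL_tens.
  rewrite (_ : tens (opL i j 1) u = 0) ?add0r //.
  by apply/ffunP => k; rewrite !ffunE /opL !mderivC !mulr0 subrr scaler0.
have [_ /(_ S subS)] := irr; case=> [A u AL Su|S0|//].
  exact: (orth_stable rep subS SF).
by case: u0N0; apply: S0.
Qed.

Lemma actD_linear : linear (actD b : M -> M).
Proof.
move=> x v w; apply/ffunP => k; rewrite !ffunE -!mul_mpolyC.
have -> : opD (x%:MP * v k + w k) = x%:MP * opD (v k) + opD (w k).
  rewrite /opD mulr_sumr -big_split /=; apply: eq_bigr => r _.
  by rewrite mderivD mderiv_mulC mulrDr mulrCA.
by ring.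
Qed.

Lemma actP_linear i : linear (actP i : M -> M).
Proof. by move=> x v w; apply/ffunP => k; rewrite !ffunE mderivD mderivZ. Qed.

Let triple_mod (w : M) (x : C) (y : triple C n d) :=
  [/\ W (y.1.1 - x *: w), forall j, W (y.1.2 j) & W y.2].

(** All operators preserve [W] and the derivatives of w lie in [W], so modulo [W] only the entry -D
    acts on e_(n+1) (x) w, by -e. *)
Lemma bigA_mod (w : M) (e a c : C) y :
  actD b w = e *: w -> (forall i, W (actP i w)) ->
  triple_mod w a y -> triple_mod w ((- e - c) * a) (bigA rho b y - c *: y).
Proof.
move=> De Pw [W1 W2 W3].
have actDB : actD b y.1.1 = actD b (y.1.1 - a *: w) + (a * e) *: w.
  by rewrite -scalerA -De addrC -actD_linear addrC subrK.
have WS x v : W v -> W (x *: v) by exact: subspaceZ.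
have WB v v' : W v -> W v' -> W (v - v') by exact: subspaceB.
have Wa v v' : W v -> W v' -> W (v + v') by exact: subspaceD.
split=> [|j|].
- have -> : (bigA rho b y - c *: y).1.1 - ((- e - c) * a) *: w =
      - actD b (y.1.1 - a *: w) - (\sum_i actJ rho b i (y.1.2 i))
      - c *: (y.1.1 - a *: w).
    rewrite /= actDB; move: (actD b _) (\sum_i _) => x1 x2.
    apply/ffunP => k; rewrite !ffunE -!mul_mpolyC !(rmorphM, rmorphN, rmorphB) /=.
    by ring.
  apply: (WB); last exact: WS.
  by apply: (WB); [by apply/(subspaceN subW)/WD | apply: subspace_sum => // i _; apply: WJ].
- have -> : (bigA rho b y - c *: y).1.2 j = actP j (y.1.1 - a *: w) + a *: actP j w
      + \sum_i actL rho i j (y.1.2 i) + actJ rho b (inv j) y.2 - c *: y.1.2 j.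
    have <- : actP j y.1.1 = actP j (y.1.1 - a *: w) + a *: actP j w.
      by rewrite addrC -actP_linear addrC subrK.
    have subE (f g : {ffun idx n -> M}) : (f - g) j = f j - g j by rewrite !ffunE.
    have scaleE (f : {ffun idx n -> M}) : (c *: f) j = c *: f j by rewrite ffunE.
    by rewrite /= subE scaleE ffunE.
  apply: (WB); last exact: WS.
  apply: (Wa) (WJ _ W3); apply: (Wa); last by apply: subspace_sum => // i _; apply: WL.
  by apply: (Wa); [apply: WP | apply: WS].
- apply: (WB); last exact: WS.
  by apply: (WB); [apply: WD | apply: subspace_sum => // i _; apply: WP].
Qed.

Hypothesis b_half : forall k : nat, b != n%:R - k%:R / 2%:R.
Hypothesis torsion : forall z, shift_torsion (casimir rho)
  (fun c => forall k : nat, b != - c - k%:R) z.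

Lemma monomial_mem m u : (forall i, W (actP i (tens 'X_[m] u))) -> m != 0%MM ->
  W (tens 'X_[m] u).
Proof.
move=> Pw m0; set w := tens 'X_[m] u; set k := mdeg m.
have Dw : actD b w = (b + k%:R) *: w.
  rewrite actD_tens opD_monomial -scalerDl addrC.
  by apply/ffunP => l; rewrite !ffunE !scalerA mulrC.
(* This is (AA + b) applied to e_(n+1) (x) w; Euler's identity puts it in the kernel of [ell]. *)
pose y0 : triple C n d := (- k%:R *: w, [ffun j => actP j w], 0).
have ly0 : ell y0 = 0.
  apply/ffunP => l; rewrite ellE /= [(0 : M) l]ffunE mulr0 subr0.
  under eq_bigr => j _ do rewrite ffunE actP_tens ffunE -scalerAr.
  rewrite -scaler_sumr -/(opD 'X_[m]) opD_monomial fun_ffunZ ffunE.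
  by rewrite scalerA [in X in _ + X]scalerA -scalerDl mulNr mulrC addNr scale0r.
have [cs csP csy] := torsionA (mid y0) torsion.
(* The shift is c - 1 because AA acts on [mid] as [casimirA] minus 1. *)
pose step y c := bigA rho b y - (c - 1) *: y.
pose y1 := foldr (fun c y => step y c) y0 cs.
have [ly1 my1] : ell y1 = 0 /\ mid y1 = shifted_prod (casimirA rho) cs (mid y0).
  rewrite /y1; elim: cs {csP csy y1} => //= c cs [ly my].
  rewrite /step ell_sub mid_sub ell_bigA // mid_bigA // ly !scaler0 subr0; split=> //.
  by rewrite -my scalerBl scale1r opprB addrA subrK.
have y2 := bigA_killed b rep ly1 (etrans my1 csy).
have mod0 : triple_mod w (- k%:R) y0.
  split=> [|j|]; rewrite /= ?subrr ?ffunE //; exact: subW.1.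
have [a aN0 mod1] : exists2 a, a != 0 & triple_mod w a y1.
  rewrite /y1; elim: cs csP {csy y1 ly1 my1 y2} => [|c cs IH] csP /=.
    by exists (- k%:R) => //; rewrite oppr_eq0 Num.Theory.pnatr_eq0 mdeg_eq0.
  have [|a a0 moda] := IH; first by move=> c' c'cs; apply: csP; rewrite inE c'cs orbT.
  (* This factor is zero only for b = -c - (k - 1), which [torsion] excludes since k is positive. *)
  exists ((- (b + k%:R) - (c - 1)) * a); last exact: bigA_mod.
  rewrite mulf_neq0 //; apply/eqP => e.
  have /(_ k.-1)/eqP := csP c (mem_head _ _); apply.
  have -> : k.-1%:R = k%:R - 1 :> C.
    by rewrite -[X in X%:R - 1](@prednK k) ?lt0n ?mdeg_eq0 // -natr1 addrK.
  by rewrite -[LHS]addr0 -e; ring.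
(* After the last factor the first component is 0, yet modulo [W] it is a multiple of w. The
   coefficient vanishes only for b = n - (k - 1)/2, which [b_half] excludes. *)
have [+ _ _] := bigA_mod (b - n.*2.+1%:R) Dw Pw mod1.
rewrite y2 sub0r -scaleNr => Wcw.
set a' := - _ in Wcw.
have a'0 : a' != 0.
  rewrite oppr_eq0 mulf_neq0 //; apply/eqP => e.
  have /eqP := b_half k.-1; apply.
  have -> : k.-1%:R = k%:R - 1 :> C.
    by rewrite -[X in X%:R - 1](@prednK k) ?lt0n ?mdeg_eq0 // -natr1 addrK.
  apply: (@mulfI _ 2%:R); first by rewrite Num.Theory.pnatr_eq0.
  have N : (n.*2.+1)%:R = 2%:R * n%:R + 1 :> C by rewrite -natr1 -mul2n natrM.
  by rewrite N in e; rewrite -[LHS]addr0 -e; field.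
by rewrite -[w]scale1r -(mulVf a'0) -scalerA; apply: subspaceZ.
Qed.

(** Induction on the degree: derivatives of a monomial are multiples of monomials of smaller degree,
    as [monomial_mem] requires. *)
Lemma submodule_full w0 : W w0 -> w0 <> 0 -> forall w, W w.
Proof.
move=> Ww0 w0N0.
have WX m u : W (tens 'X_[m] u).
  have [s] := ubnP (mdeg m); elim: s m u => // s IHs m u lt_ms.
  have [->|m0] := eqVneq m 0%MM; first by rewrite mpolyX0; apply: constants_mem Ww0 w0N0 _.
  apply: monomial_mem => // i; rewrite actP_tens mderivX.
  have -> : tens ((m i)%:R *: 'X_[m - U_(i)]) u = (m i)%:R *: tens 'X_[m - U_(i)] u :> M.
    by apply/ffunP => k; rewrite !ffunE !scalerA mulrC.
  have [->|mi0] := eqVneq (m i) 0%N; first by rewrite scale0r; apply: subW.1.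
  apply: subspaceZ => //; apply: IHs.
  have := mdegD (m - U_(i)) U_(i); rewrite submK ?lep1mP // mdeg1; lia.
move=> w; rewrite [w]tens_sum; apply: subspace_sum => // k _.
rewrite [w k]mpolyE.
have -> : tens (\sum_(m <- msupp (w k)) (w k)@_m *: 'X_[m]) (delta_mx k 0) =
    \sum_(m <- msupp (w k)) (w k)@_m *: tens 'X_[m] (delta_mx k 0) :> M.
  apply/ffunP => l; rewrite ffunE sum_ffunE scaler_sumr; apply: eq_bigr => m _.
  by rewrite !ffunE !scalerA mulrC.
by apply: subspace_sum => // m _; apply: subspaceZ.
Qed.

End Submodules.

Lemma conformal_irreducible (C : numFieldType) (n d : nat)
    (rho : 'M[C]_(n.*2.+1) -> 'M[C]_d) (b : C) :
  is_rep (orth C n) rho ->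
  irreducible_module (orth C n) (fun A (u : 'cV[C]_d) => rho A *m u) ->
  (forall k : nat, b != n%:R - k%:R / 2%:R) ->
  (forall z, shift_torsion (casimir rho) (fun c => forall k : nat, b != - c - k%:R) z) ->
  irreducible_module (orth C n.+1) (act_hat rho b).
Proof.
move=> rep irr b_half tors; split.
  have [[u u0] _] := irr; exists (tens 1 u) => /ffunP e; apply: u0.
  apply/matrixP => k l; rewrite ord1 mxE.
  have /(congr1 (mcoeff 0)) := e k.
  by rewrite !ffunE mcoeffZ mcoeff1 eqxx mulr1 mcoeff0.
move=> W subW stable.
have two0 : 2%:R != 0 :> C by rewrite Num.Theory.pnatr_eq0.
have WL i j w : W w -> W (actL rho i j w).
  move=> Ww; have [<- _ _ _] := act_hat_generators b w i j two0 rep.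
  exact: stable (F_orth _ _ _) Ww.
have WD w : W w -> W (actD b w).
  move=> Ww; have [_ e _ _] := act_hat_generators b w ord0 ord0 two0 rep.
  rewrite -[actD b w]opprK -e; apply: subspaceN => //.
  exact: stable (F_orth _ _ _) Ww.
have WP i w : W w -> W (actP i w).
  move=> Ww; have [_ _ <- _] := act_hat_generators b w i i two0 rep.
  exact: stable (F_orth _ _ _) Ww.
have WJ i w : W w -> W (actJ rho b i w).
  move=> Ww; have [_ _ _ e] := act_hat_generators b w i i two0 rep.
  rewrite -[actJ rho b i w]opprK -e; apply: subspaceN => //.
  exact: stable (F_orth _ _ _) Ww.
have [[w Ww w0]|W0] := pselect (exists2 w, W w & w <> 0).
  by right=> w'; exact: (submodule_full rep irr subW WD WP WJ WL b_half tors Ww w0).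
by left=> w Ww; apply: contrapT => w0; apply: W0; exists w.
Qed.

(** * Differences of the mu_i and the first block of equal ones *)

Section DominantWeights.
Variables (C : numFieldType) (n : nat) (mu : 'rV[C]_n).
Implicit Types k l : 'I_n.

Lemma dominant_diff k l : dominant_integral mu -> (k <= l)%N ->
  exists t : nat, mu 0 k - mu 0 l = t%:R.
Proof.
case=> _ step; have [m] := ubnP (l - k)%N; elim: m l => // m IH l lt_m le_kl.
have [kl|ne_kl] := eqVneq k l; first by exists 0%N; rewrite kl subrr.
have lt_kl : (k < l)%N by rewrite ltn_neqAle ne_kl.
have ltl : (l.-1 < n)%N by have := ltn_ord l; lia.
have [||t et] := IH (Ordinal ltl); rewrite /=; try lia.
have [|s es] := step (Ordinal ltl) l; first by rewrite /=; lia.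
by exists (t + s)%N; rewrite natrD -et -es addrA subrK.
Qed.

Lemma jumps_first (S : seq nat) : (0 < n)%N -> is_jumps mu S ->
  (nth 0%N S 1 <= n)%N /\
  forall k l, (k < nth 0%N S 1)%N -> (l < nth 0%N S 1)%N -> mu 0 k = mu 0 l.
Proof.
move=> n_gt0 [S0 Sfst Slst sortS eqS].
(* A single entry would be both 0 and n. *)
have S1 : (1 < size S)%N.
  rewrite ltn_neqAle S0 andbT; apply/eqP => S1.
  by move: Slst n_gt0; rewrite -S1 /= Sfst => <-.
split.
  have [e|ne] := eqVneq 1%N (size S).-1; first by rewrite e Slst.
  rewrite -Slst ltnW //; apply: (sorted_ltn_nth ltn_trans); rewrite ?inE //; lia.
by move=> k l ltk ltl; apply/eqS; exists 0%N; rewrite Sfst S1 /= ltk ltl.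
Qed.

End DominantWeights.

Theorem theorem3p6 (R : realType) (n : nat) (hn : (0 < n)%N)
    (mu : 'rV[R[i]]_n) (S : seq nat)
    (hmu : dominant_integral mu) (hmu0 : mu <> 0) (hS : is_jumps mu S)
    (d : nat) (rho : 'M[R[i]]_(n.*2.+1) -> 'M[R[i]]_d) (hrho : is_V mu rho)
    (b : R[i])
    (hb : ~ ((exists k : nat, b = n%:R - k%:R / 2%:R) \/ Theta hn mu S b)) :
  irreducible_module (orth R[i] n.+1) (act_hat rho b).
Proof.
have [rep irr [v hwv]] := hrho.
have b_half (k : nat) : b != n%:R - k%:R / 2%:R.
  by apply/eqP => e; apply: hb; left; exists k.
have two0 : 2%:R != 0 :> R[i] by rewrite Num.Theory.pnatr_eq0.
apply: conformal_irreducible => //; apply: torsion_all hwv _ _ _ _ irr => //.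
(* With mu_k = m/2, the value k - mu_k - q lies in n - N/2. *)
- move=> k q; have [m mE] := hmu.1 k.
  have := b_half ((n - k).*2 + m + q.*2)%N; congr (b != _).
  rewrite mE !natrD -!muln2 !natrM natrB ?(ltnW (ltn_ord k)) //; by field.
- move=> q; have := b_half q.*2; congr (b != _).
  by rewrite -muln2 natrM; field.
move=> k; have [n1_le eq_n1] := jumps_first hn hS.
(* For the spin weight [Theta] is empty, but every k' is reached by lowering: from the next equal
   entry, or by the short root at the last index. *)
have [mu_spin|mu_nspin] := eqVneq mu (2%:R^-1 *: \sum_(i < n) eps _ i).
  have mu_k l : mu 0 l = 2%:R^-1.
    rewrite mu_spin !mxE summxE (bigD1 l) //= big1 => [|j /negPf jl].
      by rewrite !mxE !eqxx addr0 mulr1.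
    by rewrite !mxE eq_sym jl andbF.
  have [kn|nkn] := eqVneq k.+1 n; first by constructor 3.
  have ltk : (k.+1 < n)%N by rewrite ltn_neqAle nkn ltn_ord.
  by constructor 2; exists (Ordinal ltk); rewrite ?mu_k.
have [ltk|gek] := ltnP k.+1 (nth 0%N S 1).
  have ltkn := leq_trans ltk n1_le.
  by constructor 2; exists (Ordinal ltkn) => //; apply: eq_n1 => //; apply: ltnW.
(* From the end of the first block on, the excluded value is mu_k + 2n - (k + 1) - q with 0-based k.
   Writing mu_k = mu_1 - t puts it in mu_1 + 2n - n_1 - N, contradicting [Theta]. *)
constructor 1 => q; apply/eqP => e; apply: hb; right; split; first exact/eqP.
have [t et] := dominant_diff (k := Ordinal hn) (l := k) hmu (leq0n k).
exists (q + t + (k.+1 - nth 0%N S 1))%N.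
have kn := ltn_ord k.
rewrite e !natrD -et !natrB //; first by ring.
by rewrite -addnn; lia.
Qed.
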